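(* Let $G$ be an SE-graph with sources $r_1,\dots,r_m$ and sinks $c_1,\dots,c_n$, and let $\mathrm{Path}_G$ be its path matrix. Then for every $(I|J)\in\mathcal E^{m,n}$, $$[I|J]_{\mathrm{Path}_G,q}=\sum_{\phi\in\Phi(I|J)} w(\phi),$$ where $\Phi(I|J)$ is the set of $(I|J)$-flows in $G$.
   Context: Notation: $[p]=\{1,\dots,p\}$; $\mathcal E^{m,n}$ is the set of pairs $(I|J)$ with $I\subseteq[m]$, $J\subseteq[n]$, $|I|=|J|$. Fix a field $\mathbb K$ and $q\in\mathbb K^\ast$. An SE-graph is a finite directed graph $G=(V,E)$ embedded in the plane (planar with a fixed layout) such that: every edge is either a horizontal edge (H-edge) directed to the right or a vertical edge (V-edge) directed downward; there are distinguished vertices $r_1,\dots,r_m$ (sources) lying on a vertical line in this order upward, and $c_1,\dots,c_n$ (sinks) lying on a horizontal line in this order from left to right; sources are incident only with H-edges and sinks only with V-edges; every vertex lies on a directed path from a source to a sink. Let $W$ be the set of inner vertices (neither sources nor sinks). $\mathcal L_G$ is the $\mathbb K$-algebra of Laurent polynomials in the elements of $W$ with relations, for distinct $u,v\in W$: $uv=qvu$ if $G$ has a directed horizontal path from $u$ to $v$; $vu=quv$ if $G$ has a directed vertical path from $u$ to $v$; $uv=vu$ otherwise. Edge weights: $w(e)=v$ if $e=(u,v)$ with $u$ a source; $w(e)=u^{-1}v$ if $e=(u,v)$ is an H-edge with $u,v\in W$; $w(e)=1$ for V-edges. The weight of a directed path $e_1\cdots e_k$ is $w(e_1)\cdots w(e_k)$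 (ordered product). $\mathrm{Path}_G$ is the $m\times n$ matrix whose $(i,j)$ entry is the sum of weights of directed paths from $r_i$ to $c_j$. For $(I|J)\in\mathcal E^{m,n}$, an $(I|J)$-flow is a set of pairwise vertex-disjoint directed paths from the sources $\{r_i:i\in I\}$ to the sinks $\{c_j:j\in J\}$ (one path starting at each such source). Writing $I=\{i_1<\dots<i_k\}$, $J=\{j_1<\dots<j_k\}$, the $\ell$-th path $P_\ell$ of the flow starts at $r_{i_\ell}$ (and ends at $c_{j_\ell}$), and the weight of the flow $\phi=(P_1,\dots,P_k)$ is the ordered product $w(\phi)=w(P_1)\cdots w(P_k)$. The $q$-minor of a matrix $A=(a_{ij})$ is $[I|J]_{A,q}=\sum_{\sigma\in S_k}(-q)^{\ell(\sigma)}a_{i_1j_{\sigma(1)}}\cdots a_{i_kj_{\sigma(k)}}$ (product ordered left to right), with $\ell(\sigma)$ the number of inversions. *)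

(* Defs.v *)
From HB Require Import structures.
From mathcomp Require Import all_boot all_order all_algebra all_fingroup.
From mathcomp Require Import Rstruct.
Set Implicit Arguments. Unset Strict Implicit. Unset Printing Implicit Defensive.
Import Order.TTheory GRing.Theory Num.Theory.
Local Open Scope ring_scope.

Definition point := (Rdefinitions.R * Rdefinitions.R)%type.

Definition on_seg (a b z : point) : Prop :=
  exists t : Rdefinitions.R, 0 <= t <= 1 /\
    z = (a.1 + t * (b.1 - a.1), a.2 + t * (b.2 - a.2)).

(* Data of a directed graph drawn in the plane with distinguished sources
   r_0..r_{m-1} (= r_1..r_m of the paper) and sinks c_0..c_{n-1}.
   hedge = H-edges, vedge = V-edges. *)
Record SEgraph (m n : nat) := SEGraph {
  vert : finType;
  hedge : rel vert;
  vedge : rel vert;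
  pos : vert -> point;
  src : 'I_m -> vert;
  snk : 'I_n -> vert }.
Arguments vert {m n} s : rename.
Arguments hedge {m n} s : rename.
Arguments vedge {m n} s : rename.
Arguments pos {m n} s : rename.
Arguments src {m n} s : rename.
Arguments snk {m n} s : rename.

Section SE.
Variables (m n : nat) (G : SEgraph m n).

Definition edge : rel (vert G) := fun u v => hedge G u v || vedge G u v.

Definition is_src (v : vert G) : bool := [exists i, src G i == v].
Definition is_snk (v : vert G) : bool := [exists j, snk G j == v].
Definition inner (v : vert G) : bool := ~~ is_src v && ~~ is_snk v.

Record SE_axioms : Prop := {
  hedge_geom : forall u v, hedge G u v ->
     (pos G u).2 = (pos G v).2 /\ (pos G u).1 < (pos G v).1;
  vedge_geom : forall u v, vedge G u v ->
     (pos G u).1 = (pos G v).1 /\ (pos G v).2 < (pos G u).2;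
  (* planar embedding: distinct vertices at distinct points, no vertex in the
     interior of an edge, edges meet only at common endpoints *)
  pos_inj : injective (pos G);
  vertex_off_edges : forall w u v, edge u v ->
     on_seg (pos G u) (pos G v) (pos G w) -> w = u \/ w = v;
  edges_noncross : forall u v u' v' z, edge u v -> edge u' v' ->
     (u, v) <> (u', v') ->
     on_seg (pos G u) (pos G v) z -> on_seg (pos G u') (pos G v') z ->
     exists w, (w = u \/ w = v) /\ (w = u' \/ w = v') /\ z = pos G w;
  src_line : forall i i', (pos G (src G i)).1 = (pos G (src G i')).1;
  src_up : forall i i' : 'I_m, (i < i')%N ->
     (pos G (src G i)).2 < (pos G (src G i')).2;
  snk_line : forall j j', (pos G (snk G j)).2 = (pos G (snk G j')).2;
  snk_right : forall j j' : 'I_n, (j < j')%N ->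
     (pos G (snk G j)).1 < (pos G (snk G j')).1;
  src_not_snk : forall i j, src G i <> snk G j;
  src_no_in : forall i u, ~~ edge u (src G i);
  src_only_h : forall i u, ~~ vedge G (src G i) u && ~~ vedge G u (src G i);
  snk_no_out : forall j u, ~~ edge (snk G j) u;
  snk_only_v : forall j u, ~~ hedge G (snk G j) u && ~~ hedge G u (snk G j);
  on_src_snk_path : forall v, exists i j,
     connect edge (src G i) v /\ connect edge v (snk G j) }.

(* The algebra L_G is represented through its universal property: x maps the
   vertices (only inner ones matter) into a K-algebra A with inverses, such
   that the inner vertices are invertible and satisfy the q-commutation
   relations defining L_G. *)
Definition qtorus_rel (K : fieldType) (q : K) (A : unitAlgType K)
    (x : vert G -> A) : Prop :=
  (forall w, inner w -> x w \is a GRing.unit) /\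
  (forall u v, inner u -> inner v -> u != v ->
     (connect (hedge G) u v -> x u * x v = q *: (x v * x u)) /\
     (connect (vedge G) u v -> x v * x u = q *: (x u * x v)) /\
     (~~ connect (hedge G) u v -> ~~ connect (hedge G) v u ->
      ~~ connect (vedge G) u v -> ~~ connect (vedge G) v u ->
      x u * x v = x v * x u)).

Section Weights.
Variables (K : fieldType) (A : unitAlgType K) (x : vert G -> A).

Definition ew (u v : vert G) : A :=
  if hedge G u v then (if is_src u then x v else (x u)^-1 * x v) else 1.

(* A directed path starting at a is represented by the sequence p of the
   vertices following a; its edges are the consecutive pairs of a :: p. *)
Definition is_path (a b : vert G) (p : seq (vert G)) : bool :=
  path edge a p && (last a p == b).

Definition pw (a : vert G) (p : seq (vert G)) : A :=
  \prod_(e <- zip (a :: p) p) ew e.1 e.2.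

(* finite type of vertex sequences of length < #|V|; since G is acyclic
   (edges go right or down), every directed path is of this form. *)
Definition ptype := {l : 'I_#|vert G| & (l : nat).-tuple (vert G)}.
Definition pseq (p : ptype) : seq (vert G) := tagged p.

Definition pathmx : 'M[A]_(m, n) :=
  \matrix_(i, j) \sum_(p : ptype | is_path (src G i) (snk G j) (pseq p))
                    pw (src G i) (pseq p).
End Weights.
End SE.

(* the l-th smallest element (l = 0, ..., k-1) of a set I of size k *)
Definition elt (p : nat) (I : {set 'I_p}) (k : nat) (hI : #|I| = k)
  (l : 'I_k) : 'I_p := enum_val (cast_ord (esym hI) l).

Definition inv_count (k : nat) (s : 'S_k) : nat :=
  #|[set pr : 'I_k * 'I_k | (pr.1 < pr.2)%N && (s pr.2 < s pr.1)%N]|.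

Definition qminor (K : fieldType) (A : unitAlgType K) (m n : nat)
  (M : 'M[A]_(m, n)) (q : K) (I : {set 'I_m}) (J : {set 'I_n}) (k : nat)
  (hI : #|I| = k) (hJ : #|J| = k) : A :=
  \sum_(s : 'S_k) ((- q) ^+ inv_count s) *:
     \prod_(l < k) M (elt hI l) (elt hJ (s l)).

Definition is_flow (m n : nat) (G : SEgraph m n) (I : {set 'I_m})
  (J : {set 'I_n}) (k : nat) (hI : #|I| = k) (hJ : #|J| = k)
  (F : {ffun 'I_k -> ptype G}) : bool :=
  [forall l, [exists j in J, is_path (src G (elt hI l)) (snk G j) (pseq (F l))]]
  && [forall l, forall l', (l != l') ==>
        [disjoint (src G (elt hI l) :: pseq (F l))
                & (src G (elt hI l') :: pseq (F l'))]].

Definition flow_weight (m n : nat) (G : SEgraph m n) (K : fieldType)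
  (A : unitAlgType K) (x : vert G -> A) (I : {set 'I_m}) (k : nat)
  (hI : #|I| = k) (F : {ffun 'I_k -> ptype G}) : A :=
  \prod_(l < k) pw x (src G (elt hI l)) (pseq (F l)).

(* Main.v *)
(** Expanding the quantum minor gives a signed sum over pairs (permutation,
family of paths).  In a family that is not vertex-disjoint, planarity forces
the two paths through the first common vertex to start at consecutive sources;
exchanging the tails of these two paths at their last common vertex [z] changes
the permutation by an adjacent transposition and preserves all common vertices,
so it is an involution.  If [P] and [Q] leave [z] downwards and to the right,
the weights before and after the exchange differ by a factor [q], which cancels
against the factor [- q] of the sign.

The factor [q] is computed on exponent vectors.  For the antisymmetric form
attached to horizontal (or vertical) reachability, the pairing of a vertex [w]
with the boundary of an edge counts the endpoints of that edge equal to [w].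
The exponent vector of a path is the sum of the boundaries of its horizontal
edges, hence also, by telescoping, its end minus its start minus the boundaries
of its vertical edges; so all pairings reduce to contributions at [z]. *)

Require Import Defs.
From HB Require Import structures.
From mathcomp Require Import all_boot all_order all_algebra all_fingroup.
From mathcomp Require Import Rstruct ring lra zify.
Import Order.TTheory GRing.Theory Num.Theory.
Set Implicit Arguments. Unset Strict Implicit. Unset Printing Implicit Defensive.
Local Open Scope ring_scope.

(** * Planarity *)

Lemma on_seg_horizontal (a b : point) (t : Rdefinitions.R) :
  a.2 = b.2 -> a.1 < b.1 -> a.1 <= t <= b.1 -> on_seg a b (t, a.2).
Proof.
move=> eq2 lt1 /andP[le1 le2]; exists ((t - a.1) / (b.1 - a.1)).
have d0 : 0 < b.1 - a.1 by rewrite subr_gt0.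
split.
  apply/andP; split; first by apply: divr_ge0; rewrite subr_ge0 // ltW.
  by rewrite ler_pdivrMr // mul1r lerB.
by rewrite divfK ?gt_eqF // -eq2 subrr mulr0 addr0 addrC subrK.
Qed.

Lemma on_seg_vertical (a b : point) (t : Rdefinitions.R) :
  a.1 = b.1 -> b.2 < a.2 -> b.2 <= t <= a.2 -> on_seg a b (a.1, t).
Proof.
move=> eq1 lt2 /andP[le1 le2]; exists ((a.2 - t) / (a.2 - b.2)).
have d0 : 0 < a.2 - b.2 by rewrite subr_gt0.
split.
  apply/andP; split; first by apply: divr_ge0; rewrite subr_ge0 // ltW.
  by rewrite ler_pdivrMr // mul1r lerB.
rewrite -eq1 subrr mulr0 addr0; congr (_, _).
by rewrite -(opprB a.2 b.2) mulrN divfK ?gt_eqF // opprB addrC subrK.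
Qed.

Section Planar.
Variables (m n : nat) (G : SEgraph m n).
Hypothesis hG : SE_axioms G.
Local Notation V := (vert G).
Local Notation edge := (@Defs.edge m n G).
Local Notation px v := (pos G v).1.
Local Notation py v := (pos G v).2.

(** Moving right raises the abscissa and moving down lowers the ordinate, so this height function
    increases strictly along edges. It makes [G] acyclic and orders the common vertices of paths. *)
Definition rank (v : V) : Rdefinitions.R := px v - py v.

Lemma hedge_edge u v : hedge G u v -> edge u v.
Proof. by rewrite /edge => ->. Qed.

Lemma vedge_edge u v : vedge G u v -> edge u v.
Proof. by rewrite /edge orbC => ->. Qed.

Lemma hedge_not_vedge u v : hedge G u v -> vedge G u v = false.
Proof.
move=> /(hedge_geom hG) [_ lt1]; apply/negP => /(vedge_geom hG) [eq1 _].
by move: lt1; rewrite eq1 ltxx.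
Qed.

Lemma edge_coord u v : edge u v -> px u <= px v /\ py v <= py u.
Proof.
by case/orP=> [/(hedge_geom hG)|/(vedge_geom hG)] [-> l]; split=> //; apply: ltW.
Qed.

Lemma edge_rank u v : edge u v -> rank u < rank v.
Proof.
by rewrite /rank; case/orP=> [/(hedge_geom hG)|/(vedge_geom hG)] [e l]; lra.
Qed.

(** The nearer of two distinct heads would lie inside the longer edge, against [vertex_off_edges].
    With the three analogues below, the H-edges form disjoint chains, and so do the V-edges. *)
Lemma hedge_out_unique u v w : hedge G u v -> hedge G u w -> v = w.
Proof.
wlog le_vw : v w / px v <= px w => [th hv hw|hv hw].
  by case: (leP (px v) (px w)) => [/th->//|/ltW /th ->].
have [ev lv] := hedge_geom hG hv; have [ew lw] := hedge_geom hG hw.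
have [||] // := @vertex_off_edges _ _ _ hG v u w (hedge_edge hw).
  rewrite (surjective_pairing (pos G v)) -ev; apply: on_seg_horizontal => //.
  by rewrite ltW.
by move=> e; move: lv; rewrite e ltxx.
Qed.

Lemma hedge_in_unique u v w : hedge G v u -> hedge G w u -> v = w.
Proof.
wlog le_vw : v w / px w <= px v => [th hv hw|hv hw].
  by case: (leP (px w) (px v)) => [/th->//|/ltW /th ->].
have [ev lv] := hedge_geom hG hv; have [ew lw] := hedge_geom hG hw.
have [||] // := @vertex_off_edges _ _ _ hG v w u (hedge_edge hw).
  rewrite (surjective_pairing (pos G v)) ev -ew; apply: on_seg_horizontal => //.
  by rewrite le_vw ltW.
by move=> e; move: lv; rewrite e ltxx.
Qed.

Lemma vedge_out_unique u v w : vedge G u v -> vedge G u w -> v = w.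
Proof.
wlog le_vw : v w / py w <= py v => [th hv hw|hv hw].
  by case: (leP (py w) (py v)) => [/th->//|/ltW /th ->].
have [ev lv] := vedge_geom hG hv; have [ew lw] := vedge_geom hG hw.
have [||] // := @vertex_off_edges _ _ _ hG v u w (vedge_edge hw).
  rewrite (surjective_pairing (pos G v)) -ev; apply: on_seg_vertical => //.
  by rewrite le_vw ltW.
by move=> e; move: lv; rewrite e ltxx.
Qed.

Lemma vedge_in_unique u v w : vedge G v u -> vedge G w u -> v = w.
Proof.
wlog le_vw : v w / py v <= py w => [th hv hw|hv hw].
  by case: (leP (py v) (py w)) => [/th->//|/ltW /th ->].
have [ev lv] := vedge_geom hG hv; have [ew lw] := vedge_geom hG hw.
have [||] // := @vertex_off_edges _ _ _ hG v w u (vedge_edge hw).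
  rewrite (surjective_pairing (pos G v)) ev -ew; apply: on_seg_vertical => //.
  by rewrite le_vw ltW.
by move=> e; move: lv; rewrite e ltxx.
Qed.

Lemma path_coord a p v : path edge a p -> v \in a :: p ->
  px a <= px v /\ py v <= py a.
Proof.
elim: p a => [|b p IH] a /=; first by rewrite inE => _ /eqP ->.
case/andP=> /edge_coord [l1 l2] pp; rewrite in_cons => /orP[/eqP ->//|].
by case/(IH _ pp) => l3 l4; split; [apply: le_trans l3|apply: le_trans l2].
Qed.

Lemma path_coord_last a p v : path edge a p -> v \in a :: p ->
  px v <= px (last a p) /\ py (last a p) <= py v.
Proof.
elim: p a v => [|b p IH] a v /=; first by rewrite inE => _ /eqP ->.
case/andP=> ab pp; rewrite in_cons => /orP[/eqP ->|/(IH _ _ pp)//].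
have [l1 l2] := edge_coord ab.
by have [l3 l4] := IH _ _ pp (mem_head _ _);
  split; [apply: le_trans l3|apply: le_trans l2].
Qed.

Lemma path_rank a p v : path edge a p -> v \in p -> rank a < rank v.
Proof.
elim: p a => [|b p IH] a //= /andP[/edge_rank ab pp].
rewrite in_cons => /orP[/eqP ->//|/(IH _ pp)]; exact: lt_trans.
Qed.

Lemma path_rank_last a p z v : path edge a (rcons p z) -> v \in a :: p ->
  rank v < rank z.
Proof.
rewrite rcons_path => /andP[pp /edge_rank l] vp; apply: le_lt_trans l.
by have [l1 l2] := path_coord_last pp vp; rewrite /rank lerB.
Qed.

Lemma path_uniq a p : path edge a p -> uniq (a :: p).
Proof.
elim: p a => [|b p IH] a //= /andP[ab pp].
have := IH b pp => /= ->; rewrite andbT; apply/negP => /(@path_rank a (b :: p)).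
by rewrite /= ab pp ltxx => /(_ isT).
Qed.

(** Ensures that every directed path is represented in [ptype]. *)
Lemma path_size a p : path edge a p -> (size p < #|V|)%N.
Proof. by move/path_uniq/card_uniqP => /= <-; apply: max_card. Qed.

Lemma connect_hedge_coord u v : connect (hedge G) u v ->
  py u = py v /\ px u <= px v.
Proof.
case/connectP=> p; elim: p u => [|b p IH] u /=; first by move=> _ ->.
case/andP=> /(hedge_geom hG) [e1 l1] /IH{}IH /IH[e2 l2].
by rewrite e1 e2; split => //; apply: le_trans l2; apply: ltW.
Qed.

Lemma connect_vedge_coord u v : connect (vedge G) u v ->
  px u = px v /\ py v <= py u.
Proof.
case/connectP=> p; elim: p u => [|b p IH] u /=; first by move=> _ ->.
case/andP=> /(vedge_geom hG) [e1 l1] /IH{}IH /IH[e2 l2].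
by rewrite e1 e2; split => //; apply: le_trans l2 _; apply: ltW.
Qed.

Lemma pos_eq u v : px u = px v -> py u = py v -> u = v.
Proof.
move=> e1 e2; apply: (pos_inj hG).
by rewrite (surjective_pairing (pos G u)) e1 e2 -surjective_pairing.
Qed.

Lemma edge_src u i : edge u (src G i) = false.
Proof. exact/negbTE/(src_no_in hG). Qed.

Lemma edge_snk u j : edge (snk G j) u = false.
Proof. exact/negbTE/(snk_no_out hG). Qed.

Lemma edge_tail_not_snk u v : edge u v -> ~~ is_snk u.
Proof. by move=> uv; apply/existsP => -[j /eqP e]; move: uv; rewrite -e edge_snk. Qed.

Lemma edge_head_not_src u v : edge u v -> ~~ is_src v.
Proof. by move=> uv; apply/existsP => -[j /eqP e]; move: uv; rewrite -e edge_src. Qed.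

Lemma hedge_head_inner u v : hedge G u v -> inner v.
Proof.
move=> uv; rewrite /inner (edge_head_not_src (hedge_edge uv)) /=.
apply/existsP => -[j /eqP e]; have /andP[_] := snk_only_v hG j u.
by rewrite e uv.
Qed.

(** Every vertex has a descending path to a sink, and the last edge into a sink is vertical. A
    vertex that is not a sink therefore lies strictly above the common height of the sinks. *)
Lemma py_snk_le v j : py (snk G j) <= py v ?= iff is_snk v.
Proof.
have [i [j' [_ /connectP[p pp e]]]] := on_src_snk_path hG v.
rewrite (snk_line hG j j').
case: (lastP p) pp e => [_ /= <-|q c].
  split=> //; rewrite eqxx; apply/esym/existsP; by exists j'.
rewrite rcons_path last_rcons => /andP[pq qc] e; subst c.
have [_ l] := path_coord_last pq (mem_head _ _).
have qv : vedge G (last v q) (snk G j').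
  by have /andP[_ /negbTE h] := snk_only_v hG j' (last v q); move: qc; rewrite /edge h.
have [_ lt] := vedge_geom hG qv.
have {l}lt := lt_le_trans lt l.
split; first exact: ltW.
rewrite lt_eqF //; apply/esym/existsP => -[j2 /eqP e].
by move: lt; rewrite -e (snk_line hG j' j2) ltxx.
Qed.

(** * Sides of a path, and paths that cannot cross without meeting *)

(** A discrete substitute for lying on the upper right side of the polyline [P]: only its vertices
    are consulted. *)
Definition weakly_NE (P : seq V) (u : V) : Prop :=
  exists2 y, y \in P & px y <= px u /\ py y <= py u.

Definition weakly_SW (P : seq V) (u : V) : Prop :=
  exists2 y, y \in P & px u <= px y /\ py u <= py y.

(** The two segments meet at the point with the abscissa of [u] and the ordinate of [y], and edges
    of [G] meet only in common endpoints. *)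
Lemma hv_cross y y' u v : hedge G y y' -> vedge G u v ->
  px y <= px u <= px y' -> py v <= py y <= py u ->
  exists2 w, w \in [:: y; y'] & w \in [:: u; v].
Proof.
move=> hy vu xin yin.
have [ey ly] := hedge_geom hG hy; have [eu lu] := vedge_geom hG vu.
have dis : (y, y') <> (u, v).
  by move=> -[e1 e2]; move: vu; rewrite -e1 -e2 (hedge_not_vedge hy).
have [w [w1 [w2 _]]] := edges_noncross hG (hedge_edge hy) (vedge_edge vu) dis
  (on_seg_horizontal ey ly xin) (on_seg_vertical eu lu yin).
by exists w; rewrite !inE; apply/orP; [case: w1|case: w2] => ->; rewrite eqxx; auto.
Qed.

(* The polyline [a :: p] can be passed on its right only beyond its end. *)
Lemma weakly_NE_step a p u v : path edge a p -> edge u v ->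
  u \notin a :: p -> v \notin a :: p -> weakly_NE (a :: p) u ->
  weakly_NE (a :: p) v \/
  [/\ px (last a p) <= px u, px u = px v & py v < py (last a p) <= py u].
Proof.
move=> pp uv uP vP NEu.
case/orP: uv => [/(hedge_geom hG)[e l]|vuv].
  have [y yP [x0 h0]] := NEu.
  by left; exists y => //; rewrite -e; split => //; apply: le_trans x0 (ltW l).
have [eu lu] := vedge_geom hG vuv.
elim: p a pp uP vP NEu => [|b p IH] a /=.
  move=> _ uP vP [y]; rewrite inE => /eqP-> [x0 h0].
  case: (leP (py a) (py v)) => h; last by right; rewrite x0 eu h0.
  by left; exists a; rewrite ?inE // -eu.
case/andP=> ab pp; rewrite in_cons negb_or => /andP[ua ub].
rewrite in_cons negb_or => /andP[va vb].
case=> y yP [x0 h0]; have [l1 l2] := edge_coord ab.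
have [bx|bx] := leP (px b) (px u).
  have NEb : weakly_NE (b :: p) u.
    move: yP; rewrite in_cons => /orP[/eqP e|yP]; last by exists y.
    by exists b; rewrite ?mem_head //; split=> //; apply: le_trans l2 _; rewrite -e.
  case: (IH b pp ub vb NEb) => [[w wP hw]|]; last by right.
  by left; exists w => //; rewrite in_cons wP orbT.
have {yP} ya : y = a.
  move: yP; rewrite in_cons => /orP[/eqP//|yP].
  have [l _] := path_coord pp yP.
  by move: (le_lt_trans x0 bx); rewrite ltNge l.
subst y; have [av|av] := leP (py a) (py v).
  by left; exists a; rewrite ?mem_head // -eu.
have hab : hedge G a b.
  case/orP: ab => // /(vedge_geom hG) [e _].
  by move: (le_lt_trans x0 bx); rewrite e ltxx.
have [||w] := hv_cross hab vuv; [by rewrite x0 ltW|by rewrite h0 ltW|].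
rewrite !inE => w1 w2; case/orP: w2 => /eqP e; subst w.
  by move: ub; rewrite in_cons negb_or; case/orP: w1 ua => ->.
by move: vb; rewrite in_cons negb_or; case/orP: w1 va => ->.
Qed.

(** Mirror image of [weakly_NE_step]: here only an H-edge can leave the region, by passing weakly
    below the last vertex. *)
Lemma weakly_SW_step a p u v : path edge a p -> edge u v ->
  u \notin a :: p -> v \notin a :: p -> weakly_SW (a :: p) u ->
  weakly_SW (a :: p) v \/
  [/\ py u <= py (last a p), py u = py v & px u <= px (last a p) < px v].
Proof.
move=> pp uv uP vP SWu.
case/orP: uv => [huv|/(vedge_geom hG)[e l]]; last first.
  have [y yP [x0 h0]] := SWu.
  by left; exists y => //; rewrite -e; split => //; apply: le_trans (ltW l) _.
have [eu lu] := hedge_geom hG huv.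
elim: p a pp uP vP SWu => [|b p IH] a /=.
  move=> _ uP vP [y]; rewrite inE => /eqP-> [x0 h0].
  case: (leP (px v) (px a)) => h; last by right; rewrite h0 eu x0.
  by left; exists a; rewrite ?inE // -eu.
case/andP=> ab pp; rewrite in_cons negb_or => /andP[ua ub].
rewrite in_cons negb_or => /andP[va vb].
case=> y yP [x0 h0]; have [l1 l2] := edge_coord ab.
have [bx|bx] := leP (py u) (py b).
  have SWb : weakly_SW (b :: p) u.
    move: yP; rewrite in_cons => /orP[/eqP e|yP]; last by exists y.
    by exists b; rewrite ?mem_head //; split=> //; apply: le_trans l1; rewrite -e.
  case: (IH b pp ub vb SWb) => [[w wP hw]|]; last by right.
  by left; exists w => //; rewrite in_cons wP orbT.
have {yP} ya : y = a.
  move: yP; rewrite in_cons => /orP[/eqP//|yP].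
  have [_ l] := path_coord pp yP.
  by move: (le_lt_trans l bx); rewrite ltNge h0.
subst y; have [av|av] := leP (px v) (px a).
  by left; exists a; rewrite ?mem_head // -eu.
have vab : vedge G a b.
  case/orP: ab => // /(hedge_geom hG) [e _].
  by move: (lt_le_trans bx h0); rewrite e ltxx.
have [||w] := hv_cross huv vab; [by rewrite x0 ltW|by rewrite h0 ltW|].
rewrite !inE => w2 w1; case/orP: w2 => /eqP e; subst w.
  by move: ub; rewrite in_cons negb_or; case/orP: w1 ua => ->.
by move: vb; rewrite in_cons negb_or; case/orP: w1 va => ->.
Qed.

Lemma snk_mem_path a p j : path edge a p -> snk G j \in a :: p ->
  last a p = snk G j.
Proof.
elim: p a => [|b p IH] a /=; first by rewrite inE => _ /eqP ->.
case/andP=> ab pp; rewrite in_cons => /orP[/eqP e|/(IH _ pp)//].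
by move: ab; rewrite -e edge_snk.
Qed.

Lemma px_snk (j j' : 'I_n) : px (snk G j) <= px (snk G j') -> (j <= j')%N.
Proof. by move=> h; rewrite leqNgt; apply/negP => /(snk_right hG); rewrite ltNge h. Qed.

(** Being weakly north-east of the first path is carried along the second: the exceptional case of
    [weakly_NE_step] would put a vertex below the sinks. *)
Lemma disjoint_paths_order a p b p' j j' :
  path edge a p -> path edge b p' ->
  last a p = snk G j -> last b p' = snk G j' ->
  {in b :: p', forall v, v \notin a :: p} -> weakly_NE (a :: p) b ->
  (j < j')%N.
Proof.
move=> pp + lp; elim: p' b => [|c p' IH] b /=; last first.
  case/andP=> bc pp' lp' dis NEb.
  have cP : c \notin a :: p by apply: dis; rewrite !inE eqxx orbT.
  apply: (IH c) => // [v vp|]; first by apply: dis; rewrite in_cons vp orbT.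
  have [|//|[_ _]] := weakly_NE_step pp bc _ cP NEb; first exact/dis/mem_head.
  by rewrite lp ltNge (py_snk_le c j).
move=> _ -> dis [y yP [x0 h0]].
(* A vertex of the first path that is not above a sink is itself a sink, hence the end of that
   path. *)
have [le_y /esym] := py_snk_le y j'; rewrite eq_le le_y h0 => /existsP[i /eqP yi].
subst y; have := snk_mem_path pp yP; rewrite lp => e.
move: x0; rewrite -e => /px_snk; rewrite leq_eqVlt => /orP[/eqP jj|//].
have /negP[] := dis _ (mem_head _ _).
by rewrite -(ord_inj jj) -lp mem_last.
Qed.

(* A path caught between two paths that meet at [z] cannot escape. *)
Lemma trapped_path a p b p' c r j z :
  path edge a p -> path edge b p' -> last a p = z -> last b p' = z ->
  ~~ is_snk z -> path edge c r -> last c r = snk G j ->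
  {in c :: r, forall v, (v \notin a :: p) && (v \notin b :: p')} ->
  weakly_NE (a :: p) c -> weakly_SW (b :: p') c -> False.
Proof.
move=> pa pb la lb zs; elim: r c => [|d r IH] c /=.
  move=> _ -> _ [y yP [_ h0]] _.
  have [le_z /esym] := py_snk_le z j; rewrite (negbTE zs) eq_le le_z /=.
  have [_] := path_coord_last pa yP; rewrite la => /le_trans -> //.
case/andP=> cd pr lr dis NEc SWc.
have /andP[ca cb] := dis _ (mem_head _ _).
have /andP[da db] : (d \notin a :: p) && (d \notin b :: p').
  by apply: dis; rewrite !inE eqxx orbT.
have za : z \in a :: p by rewrite -la mem_last.
have off : ~ on_seg (pos G c) (pos G d) (pos G z).
  move=> /(vertex_off_edges hG cd)[] e; first by move: ca; rewrite -e za.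
  by move: da; rewrite -e za.
have dis' : {in d :: r, forall v, (v \notin a :: p) && (v \notin b :: p')}.
  by move=> v vr; apply: dis; rewrite in_cons vr orbT.
(* An escape past the end of one path would put [z] on the edge from [c] to [d], because the other
   path bounds [c] from the opposite side. *)
have [NEd|[x1 x2 /andP[y1 y2]]] := weakly_NE_step pa cd ca da NEc; last first.
  rewrite la in x1 y1 y2; case: SWc => y yP [x3 _].
  have [x4 _] := path_coord_last pb yP; rewrite lb in x4.
  have ez : px c = px z by apply/eqP; rewrite eq_le x1 (le_trans x3 x4).
  apply: off; rewrite (surjective_pairing (pos G z)) -ez.
  apply: on_seg_vertical; rewrite ?y2 ?ltW //; exact: lt_le_trans y2.
have [SWd|[y1 y2 /andP[x1 x2]]] := weakly_SW_step pb cd cb db SWc; last first.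
  rewrite lb in y1 x1 x2; case: NEc => y yP [_ y3].
  have [_ y4] := path_coord_last pa yP; rewrite la in y4.
  have ez : py c = py z by apply/eqP; rewrite eq_le y1 (le_trans y4 y3).
  apply: off; rewrite (surjective_pairing (pos G z)) -ez.
  apply: on_seg_horizontal; rewrite ?x1 ?ltW //; exact: le_lt_trans x2.
exact: (IH d).
Qed.
End Planar.

(** * Commutation up to a power of [q] *)

Section QCommute.
Variables (K : fieldType) (q : K) (A : unitAlgType K).
Hypothesis hq : q != 0.

Definition qcomm (e : int) (a b : A) : Prop := a * b = q ^ e *: (b * a).

Lemma qcomm1l b : qcomm 0 1 b.
Proof. by rewrite /qcomm expr0z scale1r mul1r mulr1. Qed.

Lemma qcomm_sym e a b : qcomm e a b -> qcomm (- e) b a.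
Proof.
by move=> h; rewrite /qcomm h scalerA -expfzDr // addNr expr0z scale1r.
Qed.

Lemma qcommMl e f a b c : qcomm e a c -> qcomm f b c -> qcomm (e + f) (a * b) c.
Proof.
move=> h1 h2; rewrite /qcomm -mulrA h2 -scalerAr (mulrA a) h1 -scalerAl scalerA.
by rewrite -mulrA expfzDr // (mulrC (q ^ e)).
Qed.

Lemma qcommVl e a c : a \is a GRing.unit -> qcomm e a c -> qcomm (- e) a^-1 c.
Proof.
move=> ua h; apply: (mulrI ua); apply: (mulIr ua).
rewrite mulrA divrr // mul1r -scalerAr -scalerAl mulrA mulrVK //.
by rewrite h scalerA -expfzDr // addNr expr0z scale1r.
Qed.

Lemma qcommMr e f a b c : qcomm e c a -> qcomm f c b -> qcomm (e + f) c (a * b).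
Proof.
move=> /qcomm_sym h1 /qcomm_sym h2; rewrite -[_ + _]opprK opprD.
exact/qcomm_sym/qcommMl.
Qed.

Lemma qcommVr e a c : a \is a GRing.unit -> qcomm e c a -> qcomm (- e) c a^-1.
Proof. by move=> ua h; rewrite -[- e]opprK; apply/qcomm_sym/qcommVl/qcomm_sym. Qed.

Lemma qcomm1r b : qcomm 0 b 1.
Proof. by rewrite -oppr0; apply/qcomm_sym/qcomm1l. Qed.

End QCommute.

(** * Exponent vectors and bilinear forms *)

Section Bilinear.
Variable V : finType.
Implicit Types (lam : V -> V -> int) (E F : {ffun V -> int}).

Definition delta (u : V) : {ffun V -> int} := [ffun v => (v == u)%:Z].

Definition bil lam E F : int := \sum_u \sum_v E u * F v * lam u v.

Lemma bilDl lam E E' F : bil lam (E + E') F = bil lam E F + bil lam E' F.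
Proof.
rewrite /bil -big_split; apply: eq_bigr => u _; rewrite -big_split.
by apply: eq_bigr => v _; rewrite ffunE /= !mulrDl.
Qed.

Lemma bilDr lam E F F' : bil lam E (F + F') = bil lam E F + bil lam E F'.
Proof.
rewrite /bil -big_split; apply: eq_bigr => u _; rewrite -big_split.
by apply: eq_bigr => v _; rewrite ffunE /= mulrDr !mulrDl.
Qed.

Lemma bilNl lam E F : bil lam (- E) F = - bil lam E F.
Proof.
rewrite /bil -sumrN; apply: eq_bigr => u _; rewrite -sumrN.
by apply: eq_bigr => v _; rewrite ffunE !mulNr.
Qed.

Lemma bilNr lam E F : bil lam E (- F) = - bil lam E F.
Proof.
rewrite /bil -sumrN; apply: eq_bigr => u _; rewrite -sumrN.
by apply: eq_bigr => v _; rewrite ffunE mulrN mulNr.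
Qed.

Lemma bil0l lam F : bil lam 0 F = 0.
Proof. by rewrite /bil big1 // => u _; rewrite big1 // => v _; rewrite ffunE !mul0r. Qed.

Lemma bil0r lam E : bil lam E 0 = 0.
Proof. by rewrite /bil big1 // => u _; rewrite big1 // => v _; rewrite ffunE mulr0 mul0r. Qed.

Lemma sum_delta (u : V) (f : V -> int) : \sum_v delta u v * f v = f u.
Proof.
rewrite (bigD1 u) //= ffunE eqxx mul1r big1 ?addr0 // => v /negbTE vu.
by rewrite ffunE vu mul0r.
Qed.

Lemma bil_deltar lam E v : bil lam E (delta v) = \sum_u E u * lam u v.
Proof.
apply: eq_bigr => u _; rewrite -(sum_delta v (fun v => E u * lam u v)).
by apply: eq_bigr => w _; rewrite mulrAC mulrC.
Qed.

Lemma bil_delta lam u v : bil lam (delta u) (delta v) = lam u v.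
Proof. by rewrite bil_deltar sum_delta. Qed.

Lemma bil_subform lam lam' E F :
  bil (fun u v => lam u v - lam' u v) E F = bil lam E F - bil lam' E F.
Proof.
rewrite /bil -sumrN -big_split; apply: eq_bigr => u _; rewrite -sumrN -big_split.
by apply: eq_bigr => v _; rewrite /= mulrBr.
Qed.

Lemma bil_antisym lam E F : (forall u v, lam u v = - lam v u) ->
  bil lam E F = - bil lam F E.
Proof.
move=> h; rewrite /bil exchange_big -sumrN; apply: eq_bigr => u _.
by rewrite -sumrN; apply: eq_bigr => v _; rewrite h mulrN (mulrC (E v)).
Qed.

(** For acyclic [r] this is the sign of the reachability order: 1, -1, or 0 for equal or unrelated
    vertices. *)
Definition conn_form (r : rel V) (u v : V) : int :=
  (connect r u v)%:Z - (connect r v u)%:Z.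

Lemma conn_form_antisym r u v : conn_form r u v = - conn_form r v u.
Proof. by rewrite /conn_form opprB. Qed.

Definition boundary (r : rel V) (a : V) (p : seq V) : {ffun V -> int} :=
  \sum_(e <- zip (a :: p) p | r e.1 e.2) (delta e.2 - delta e.1).

(** The unsigned counterpart of [boundary]; [bil_boundary] shows that it is what [conn_form] yields
    when paired with a boundary. *)
Definition degree (r : rel V) (a : V) (p : seq V) (w : V) : int :=
  \sum_(e <- zip (a :: p) p | r e.1 e.2) ((w == e.1)%:Z + (w == e.2)%:Z).

Lemma mem_zip_path (a : V) p e :
  e \in zip (a :: p) p -> (e.1 \in belast a p) && (e.2 \in p).
Proof.
elim: p a => [|b p IH] a //=; rewrite in_cons => /orP[/eqP -> /=|/IH /andP[h1 h2]].
  by rewrite !mem_head.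
by rewrite !in_cons h1 h2 !orbT.
Qed.

Lemma belast_sub (a : V) p w : w \in belast a p -> w \in a :: p.
Proof. by rewrite lastI mem_rcons in_cons orbC => ->. Qed.

Lemma degree_notin r a p w : w \notin a :: p -> degree r a p w = 0.
Proof.
move=> wp; rewrite /degree big_seq_cond big1 // => e /andP[/mem_zip_path/andP[h1 h2] _].
have /negbTE -> : w != e.1.
  by apply: contraNneq wp => ->; apply: belast_sub.
by have /negbTE -> : w != e.2 by apply: contraNneq wp => ->; rewrite in_cons h2 orbT.
Qed.

Lemma degree_cons r a b p w :
  degree r a (b :: p) w =
  (if r a b then (w == a)%:Z + (w == b)%:Z else 0) + degree r b p w.
Proof. by rewrite /degree /= big_cons /=; case: ifP; rewrite ?add0r. Qed.

Lemma boundary_cons r a b p :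
  boundary r a (b :: p) = (if r a b then delta b - delta a else 0) + boundary r b p.
Proof. by rewrite /boundary /= big_cons /=; case: ifP; rewrite ?add0r. Qed.

Lemma degree_start r a b p : a \notin b :: p -> degree r a (b :: p) a = (r a b)%:Z.
Proof.
move=> ap; rewrite degree_cons degree_notin // addr0 eqxx.
by case: (r a b) => //; move: ap; rewrite in_cons negb_or => /andP[/negbTE->].
Qed.

(** No edge of a path without repetition leaves its last vertex, so each incident edge counts there
    with sign +1 in both sums. *)
Lemma boundary_last r a p : uniq (a :: p) ->
  boundary r a p (last a p) = degree r a p (last a p).
Proof.
move=> up; rewrite /boundary /degree sum_ffunE big_seq_cond [RHS]big_seq_cond.
apply: eq_bigr => e /andP[/mem_zip_path/andP[h1 _] _]; rewrite !ffunE.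
have /negbTE -> : last a p != e.1; last by rewrite subr0 add0r.
by move: up; rewrite lastI rcons_uniq => /andP[+ _]; apply: contraNneq => ->.
Qed.

(** * Pairing with boundaries when the edges form disjoint chains *)

Section Functional.
Variables (r : rel V) (d : Order.disp_t) (T : porderType d) (rk : V -> T).
Hypothesis r_out : forall u v w, r u v -> r u w -> v = w.
Hypothesis r_in : forall u v w, r v u -> r w u -> v = w.
Hypothesis r_rk : forall u v, r u v -> (rk u < rk v)%O.

Lemma connect_rank u v : connect r u v -> (rk u <= rk v)%O.
Proof.
case/connectP=> p; elim: p u => [|b p IH] u /=; first by move=> _ ->.
by case/andP=> /r_rk ub /IH{}IH /IH; apply: le_trans (ltW ub).
Qed.

Lemma connect_tail u v w : r u v -> w != u -> connect r v w = connect r u w.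
Proof.
move=> uv wu; apply/idP/idP; first by apply: connect_trans; apply: connect1.
case/connectP=> -[/= _ e|b p /= /andP[ub pp] ->]; first by rewrite e eqxx in wu.
by rewrite (r_out uv ub); apply/connectP; exists p.
Qed.

Lemma connect_head u v w : r u v -> w != v -> connect r w v = connect r w u.
Proof.
move=> uv wv; apply/idP/idP => [|h]; last exact: connect_trans h (connect1 uv).
case/connectP=> p; case: (lastP p) => [/= _ e|p' b]; first by rewrite e eqxx in wv.
rewrite rcons_path last_rcons => /andP[pp lb] e; subst b.
by rewrite (r_in uv lb); apply/connectP; exists p'.
Qed.

(** On a chain, a vertex other than [u] and [v] is related to both of them in the same way, so its
    two terms cancel. Only the two endpoints contribute, each with 1. *)
Lemma conn_form_edge u v w : r u v ->
  conn_form r w v - conn_form r w u = (w == u)%:Z + (w == v)%:Z.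
Proof.
move=> uv; have ruv := r_rk uv.
have nvu : connect r v u = false.
  by apply/negP => /connect_rank; rewrite (lt_geF ruv).
have uv1 : connect r u v by apply: connect1.
rewrite /conn_form; have [-> | wu] := eqVneq w u.
  rewrite uv1 nvu connect0; case: eqVneq => [e|] //.
  by rewrite e ltxx in ruv.
have [-> | wv] := eqVneq w v; first by rewrite uv1 nvu connect0.
by rewrite (connect_tail uv wu) (connect_head uv wv) subrr.
Qed.

Lemma bil_boundary E a p :
  bil (conn_form r) E (boundary r a p) = \sum_w E w * degree r a p w.
Proof.
elim: p a => [|b p IH] a.
  by rewrite /boundary big_nil bil0r big1 // => w _; rewrite /degree big_nil mulr0.
rewrite boundary_cons bilDr IH.
under [RHS]eq_bigr do rewrite degree_cons mulrDr.
rewrite big_split /=; congr (_ + _); case: ifP => ab; last first.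
  by rewrite bil0r big1 // => w _; rewrite mulr0.
rewrite bilDr bilNr !bil_deltar -sumrB; apply: eq_bigr => w _.
by rewrite -mulrBr conn_form_edge.
Qed.

Lemma bil_boundary_delta a p w :
  bil (conn_form r) (boundary r a p) (delta w) = - degree r a p w.
Proof.
rewrite (bil_antisym _ _ (conn_form_antisym r)) bil_boundary.
by rewrite (sum_delta w (degree r a p)).
Qed.

(** The form used at a crossing, where the support of one exponent vector meets the other path at
    most in [z]. *)
Lemma bil_boundary_at E a p z : (forall w, w \in a :: p -> E w != 0 -> w = z) ->
  bil (conn_form r) E (boundary r a p) = E z * degree r a p z.
Proof.
move=> h; rewrite bil_boundary (bigD1 z) //= big1 ?addr0 // => w wz.
have [wp|wp] := boolP (w \in a :: p); last by rewrite degree_notin ?mulr0.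
have [->|/(h _ wp) e] := eqVneq (E w) 0; first by rewrite mul0r.
by rewrite e eqxx in wz.
Qed.

End Functional.
End Bilinear.

(** * Weights of paths *)

Section PathWeight.
Variables (m n : nat) (G : SEgraph m n).
Hypothesis hG : SE_axioms G.
Local Notation V := (vert G).
Local Notation edge := (@Defs.edge m n G).
Variables (K : fieldType) (q : K) (A : unitAlgType K) (x : V -> A).
Hypotheses (hq : q != 0) (hx : qtorus_rel q x).

Local Notation hform := (conn_form (hedge G)).
Local Notation vform := (conn_form (vedge G)).

(** Along a vertical path from [u] to [v] the relation is [x v * x u = q *: (x u * x v)], opposite
    to the horizontal one; hence the minus sign. *)
Definition qform (u v : V) : int := hform u v - vform u v.

Definition edge_exp (u v : V) : {ffun V -> int} :=
  if hedge G u v then (if is_src u then delta v else delta v - delta u) else 0.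

Definition path_exp (a : V) (p : seq V) : {ffun V -> int} :=
  \sum_(e <- zip (a :: p) p) edge_exp e.1 e.2.

Lemma path_exp_cons a b p : path_exp a (b :: p) = edge_exp a b + path_exp b p.
Proof. by rewrite /path_exp /= big_cons. Qed.

Lemma pw_nil a : pw x a [::] = 1.
Proof. by rewrite /pw big_nil. Qed.

Lemma pw_cons a b p : pw x a (b :: p) = ew x a b * pw x b p.
Proof. by rewrite /pw /= big_cons. Qed.

Lemma pw_cat a p p' : pw x a (p ++ p') = pw x a p * pw x (last a p) p'.
Proof.
elim: p a => [|b p IH] a /=; first by rewrite pw_nil mul1r.
by rewrite !pw_cons IH mulrA.
Qed.

(** Horizontal paths keep the ordinate and vertical paths the abscissa. Distinct vertices thus fall
    under only one clause of [qtorus_rel]. *)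
Lemma connect_hv_eq u v : connect (hedge G) u v ->
  connect (vedge G) u v || connect (vedge G) v u -> u = v.
Proof.
move=> /(connect_hedge_coord hG)[e _].
by case/orP=> /(connect_vedge_coord hG)[e' _]; apply: (pos_eq hG).
Qed.

Lemma qcomm_inner u v : inner u -> inner v -> qcomm q (qform u v) (x u) (x v).
Proof.
move=> iu iv; rewrite /qform /conn_form; have [->|uv] := eqVneq u v.
  by rewrite !connect0 subrr /qcomm expr0z scale1r.
have vu : v != u by rewrite eq_sym.
have [Huv [Vuv Cuv]] := proj2 hx u v iu iv uv.
have [Hvu [Vvu _]] := proj2 hx v u iv iu vu.
have asymH : connect (hedge G) u v -> connect (hedge G) v u -> False.
  move=> /(connect_hedge_coord hG)[e l] /(connect_hedge_coord hG)[_ l'].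
  by move/eqP: uv; apply; apply: (pos_eq hG) => //; apply/eqP; rewrite eq_le l l'.
have asymV : connect (vedge G) u v -> connect (vedge G) v u -> False.
  move=> /(connect_vedge_coord hG)[e l] /(connect_vedge_coord hG)[_ l'].
  by move/eqP: uv; apply; apply: (pos_eq hG) => //; apply/eqP; rewrite eq_le l l'.
have HV := @connect_hv_eq u v; have HV' := @connect_hv_eq v u.
case h1: (connect (hedge G) u v) Huv asymH HV Cuv => Huv asymH HV Cuv.
  have -> : connect (hedge G) v u = false by apply/negP/asymH.
  have := contra_neqN (fun h => HV isT h) uv; rewrite negb_or => /andP[/negbTE-> /negbTE->].
  by rewrite /qcomm Huv // expr1z.
case h2: (connect (hedge G) v u) Hvu HV' Cuv => Hvu HV' Cuv.
  have := contra_neqN (fun h => HV' isT h) vu; rewrite negb_or => /andP[/negbTE-> /negbTE->].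
  by apply: (@qcomm_sym _ _ _ hq 1); rewrite /qcomm Hvu // expr1z.
case h3: (connect (vedge G) u v) Vuv asymV Cuv => Vuv asymV Cuv.
  have -> : connect (vedge G) v u = false by apply/negP/asymV.
  by apply: (@qcomm_sym _ _ _ hq 1); rewrite /qcomm Vuv // expr1z.
case h4: (connect (vedge G) v u) Vvu Cuv => Vvu Cuv.
  by rewrite /qcomm Vvu // expr1z.
by rewrite /qcomm Cuv // expr0z scale1r.
Qed.

Lemma hedge_tail_inner u v : hedge G u v -> is_src u = false -> inner u.
Proof.
by move=> h s; rewrite /inner s (edge_tail_not_snk hG (hedge_edge h)).
Qed.

Lemma qcomm_edge_vertex u v w : inner w ->
  qcomm q (bil qform (edge_exp u v) (delta w)) (ew x u v) (x w).
Proof.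
move=> iw; rewrite /ew /edge_exp; case: ifP => [huv|_]; last first.
  by rewrite bil0l; apply: qcomm1l.
have iv := hedge_head_inner hG huv.
case: ifP => [_|us]; first by rewrite bil_delta; apply: qcomm_inner.
have iu := hedge_tail_inner huv us.
rewrite bilDl bilNl !bil_delta addrC; apply: qcommMl => //; last exact: qcomm_inner.
by apply: qcommVl => //; [apply: (proj1 hx)|apply: qcomm_inner].
Qed.

Lemma qcomm_path_vertex a p w : inner w ->
  qcomm q (bil qform (path_exp a p) (delta w)) (pw x a p) (x w).
Proof.
move=> iw; elim: p a => [|b p IH] a.
  by rewrite pw_nil /path_exp big_nil bil0l; apply: qcomm1l.
by rewrite pw_cons path_exp_cons bilDl; apply: qcommMl => //; apply: qcomm_edge_vertex.
Qed.

Lemma qcomm_path_edge a p u v :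
  qcomm q (bil qform (path_exp a p) (edge_exp u v)) (pw x a p) (ew x u v).
Proof.
rewrite /ew /edge_exp; case: ifP => [huv|_]; last by rewrite bil0r; apply: qcomm1r.
have iv := hedge_head_inner hG huv.
case: ifP => [_|us]; first exact: qcomm_path_vertex.
have iu := hedge_tail_inner huv us.
rewrite bilDr bilNr addrC; apply: qcommMr => //; last exact: qcomm_path_vertex.
by apply: qcommVr => //; [apply: (proj1 hx)|apply: qcomm_path_vertex].
Qed.

Lemma qcomm_path a p b p' :
  qcomm q (bil qform (path_exp a p) (path_exp b p')) (pw x a p) (pw x b p').
Proof.
elim: p' b => [|c p' IH] b.
  by rewrite pw_nil {2}/path_exp big_nil bil0r; apply: qcomm1r.
by rewrite pw_cons path_exp_cons bilDr; apply: qcommMr => //; apply: qcomm_path_edge.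
Qed.

Lemma path_exp_notin a p w : w \notin a :: p -> path_exp a p w = 0.
Proof.
elim: p a => [|b p IH] a wp; first by rewrite /path_exp big_nil ffunE.
rewrite path_exp_cons ffunE IH ?addr0; last first.
  by move: wp; rewrite in_cons negb_or => /andP[].
move: wp; rewrite !inE !negb_or => /and3P[/negbTE wa /negbTE wb _].
by rewrite /edge_exp; do 2?case: ifP => _; rewrite !ffunE ?wa ?wb.
Qed.

Lemma path_exp_boundary a p : path edge a p -> ~~ is_src a ->
  path_exp a p = boundary (hedge G) a p.
Proof.
elim: p a => [|b p IH] a; first by rewrite /path_exp /boundary !big_nil.
case/andP=> ab pp /negbTE sa; rewrite path_exp_cons boundary_cons IH //.
  by rewrite /edge_exp sa.
exact: edge_head_not_src ab.
Qed.

(** The edge leaving a source has weight [x v] without the inverse of its tail, so the [delta]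
    subtracted by the boundary is added back. *)
Lemma path_exp_src i p : path edge (src G i) p -> p != [::] ->
  path_exp (src G i) p = delta (src G i) + boundary (hedge G) (src G i) p.
Proof.
case: p => // b p /andP[ab pp] _; rewrite path_exp_cons boundary_cons.
rewrite (path_exp_boundary pp) ?(edge_head_not_src hG ab) //.
have hab : hedge G (src G i) b.
  by case/orP: ab => // h; have /andP[] := src_only_h hG i b; rewrite h.
rewrite /edge_exp hab addrA; congr (_ + _).
by have -> : is_src (src G i) by [apply/existsP; exists i]; rewrite addrC subrK.
Qed.

Lemma boundary_split a p : path edge a p ->
  boundary (hedge G) a p = delta (last a p) - delta a - boundary (vedge G) a p.
Proof.
move=> pp; apply/eqP; rewrite eq_sym subr_eq eq_sym; apply/eqP.
elim: p a pp => [|b p IH] a /=; first by rewrite /boundary !big_nil subrr addr0.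
case/andP=> ab /IH{}IH; rewrite !boundary_cons addrACA IH.
have -> : (if hedge G a b then delta b - delta a else 0) +
    (if vedge G a b then delta b - delta a else 0) = delta b - delta a.
  case/orP: ab => h; first by rewrite h (hedge_not_vedge hG h) addr0.
  rewrite h; case: ifP => [/(hedge_not_vedge hG)|_]; last by rewrite add0r.
  by rewrite h.
by rewrite addrC addrA subrK.
Qed.

Lemma conn_vform0 u v : (pos G u).1 != (pos G v).1 -> vform u v = 0.
Proof.
move=> uv; rewrite /conn_form.
have -> : connect (vedge G) u v = false.
  by apply/negP => /(connect_vedge_coord hG)[/eqP]; rewrite (negbTE uv).
have -> : connect (vedge G) v u = false; last by rewrite subrr.
by apply/negP => /(connect_vedge_coord hG)[/eqP]; rewrite eq_sym (negbTE uv).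
Qed.

(** Ranks are below that of [z] before it and above that of [z] after it. *)
Lemma path_mem_eq a p z p' w : path edge a p -> last a p = z -> path edge z p' ->
  w \in a :: p -> w \in z :: p' -> w = z.
Proof.
move=> pp lp pp'; rewrite (in_cons z) lastI lp mem_rcons in_cons.
case/orP=> [/eqP//|wb] /orP[/eqP//|/(path_rank hG pp')].
suff /lt_trans/[apply] : rank w < rank z by rewrite ltxx.
move: pp lp wb; case: (lastP p) => [//|s c]; rewrite last_rcons belast_rcons.
by move=> pp e; subst c; apply: path_rank_last pp.
Qed.

(** * The power of [q] produced at a crossing *)

Section Crossing.
Variables (i : 'I_m) (j j' : 'I_n) (z d r : V) (P Q S : seq V).
Hypotheses (pS : path edge (src G i) S) (lS : last (src G i) S = z).
Hypotheses (iz : inner z) (zd : vedge G z d) (zr : hedge G z r).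
Hypotheses (pP : path edge d P) (pQ : path edge r Q).
Hypotheses (lP : last d P = snk G j) (lQ : last r Q = snk G j').
Hypothesis disPQ : forall w, w \in z :: d :: P -> w \in z :: r :: Q -> w = z.

Let ppP : path edge z (d :: P).
Proof. by rewrite /= pP vedge_edge. Qed.

Let ppQ : path edge z (r :: Q).
Proof. by rewrite /= pQ hedge_edge. Qed.

Local Notation EP := (path_exp z (d :: P)).
Local Notation EQ := (path_exp z (r :: Q)).
Local Notation ES := (path_exp (src G i) S).

Let zsrc : ~~ is_src z. Proof. by case/andP: iz. Qed.

Let S0 : S != [::].
Proof.
apply: contraNneq zsrc => S0; apply/existsP; exists i.
by rewrite -lS S0.
Qed.

Let zP : z \notin d :: P.
Proof. by have /andP[] := path_uniq hG ppP. Qed.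

Let zQ : z \notin r :: Q.
Proof. by have /andP[] := path_uniq hG ppQ. Qed.

Let EPh : EP = boundary (hedge G) z (d :: P).
Proof. exact: path_exp_boundary. Qed.

Let EQh : EQ = boundary (hedge G) z (r :: Q).
Proof. exact: path_exp_boundary. Qed.

Let EPv : EP = delta (snk G j) - delta z - boundary (vedge G) z (d :: P).
Proof. by rewrite EPh boundary_split //= lP. Qed.

Let EQv : EQ = delta (snk G j') - delta z - boundary (vedge G) z (r :: Q).
Proof. by rewrite EQh boundary_split //= lQ. Qed.

(** The extra [delta] of the source cancels the initial term of the telescoped boundary. *)
Let ESv : ES = delta z - boundary (vedge G) (src G i) S.
Proof.
rewrite path_exp_src // boundary_split // lS.
by rewrite addrA (addrC (delta (src G i))) subrK.
Qed.

Let suppP w : w \in z :: r :: Q -> EP w != 0 -> w = z.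
Proof.
move=> wQ; apply: contraNeq => wz; rewrite path_exp_notin //.
by apply: contra wz => wP; apply/eqP/disPQ.
Qed.

Let suppS p w : path edge z p -> w \in z :: p -> ES w != 0 -> w = z.
Proof.
move=> pp wQ; apply: contraNeq => wz; rewrite path_exp_notin //.
by apply: contra wz => wP; apply/eqP; apply: (path_mem_eq pS lS pp).
Qed.

Let hbil := bil_boundary_at (@hedge_out_unique _ _ _ hG) (@hedge_in_unique _ _ _ hG)
  (fun u v h => edge_rank hG (@hedge_edge _ _ G u v h)).
Let vbil := bil_boundary_at (@vedge_out_unique _ _ _ hG) (@vedge_in_unique _ _ _ hG)
  (fun u v h => edge_rank hG (@vedge_edge _ _ G u v h)).
Let vbild := bil_boundary_delta (@vedge_out_unique _ _ _ hG) (@vedge_in_unique _ _ _ hG)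
  (fun u v h => edge_rank hG (@vedge_edge _ _ G u v h)).

(** Write [s] for [snk G j]. The three terms equal [vform z s - 1], [vform s z + 1] and 1 in this
    order, and [vform] is antisymmetric. *)
Lemma crossing_exponent :
  bil qform EP ES + bil qform EP EQ + bil qform ES EQ = 1.
Proof.
have vd : hedge G z d = false.
  by apply/negP => /(hedge_not_vedge hG); rewrite zd.
have hr : vedge G z r = false by rewrite (hedge_not_vedge hG zr).
(* [Q] is entered by an H-edge, so its sink is strictly to the right of [z] and not vertically
   connected to it. *)
have xz : (pos G z).1 < (pos G (snk G j')).1.
  have [_ lt] := hedge_geom hG zr; apply: lt_le_trans lt _.
  by have [l _] := path_coord_last hG pQ (mem_head _ _); rewrite -lQ.
have zj' : vform z (snk G j') = 0 by apply: conn_vform0; rewrite lt_eqF.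
have sS t : snk G t \notin src G i :: S.
  apply/negP => /(snk_mem_path hG pS); rewrite lS => e.
  by move: iz; rewrite /inner e; case/andP=> _ /existsP[]; exists t.
have sP : snk G j' \notin z :: d :: P.
  apply/negP => s1; have s2 : snk G j' \in z :: r :: Q.
    by rewrite -lQ in_cons mem_last orbT.
  by move: xz; rewrite (disPQ s1 s2) ltxx.
have jj' : vform (snk G j) (snk G j') = 0.
  apply: conn_vform0; apply: contra sP => /eqP xj.
  rewrite -(pos_eq hG xj (snk_line hG j j')) -lP in_cons.
  by rewrite mem_last orbT.
have zd1 : (vedge G z d)%:Z = 1 by rewrite zd.
have anti := bil_antisym _ _ (conn_form_antisym (vedge G)).
have hPS : bil hform EP ES = 0.
  rewrite (bil_antisym _ _ (conn_form_antisym (hedge G))) EPh (hbil (z := z)).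
    by rewrite degree_start // vd mulr0 oppr0.
  by move=> w; apply: suppS.
have hPQ : bil hform EP EQ = 0.
  rewrite EQh (hbil (z := z)) // EPh boundary_cons vd add0r -path_exp_boundary //.
    by rewrite path_exp_notin // mul0r.
  exact: edge_head_not_src (vedge_edge zd).
have hSQ : bil hform ES EQ = ES z.
  rewrite EQh (hbil (z := z)) ?degree_start // ?zr ?mulr1 //.
  by move=> w; apply: suppS.
(* [g] is 1 or 0 according to whether [S] enters [z] by a V-edge or an H-edge; it cancels from the
   total. *)
pose g := degree (vedge G) (src G i) S z.
have ESz : ES z = 1 - g.
  by rewrite ESv !ffunE eqxx /g -lS boundary_last // (path_uniq hG).
have vS t : bil vform ES (delta t) = vform z t + degree (vedge G) (src G i) S t.
  by rewrite ESv bilDl bilNl vbild opprK bil_delta.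
have vP t : bil vform EP (delta t) =
    vform (snk G j) t - vform z t + degree (vedge G) z (d :: P) t.
  by rewrite EPv !bilDl !bilNl vbild opprK !bil_delta.
have vzz : vform z z = 0 by rewrite /conn_form subrr.
have vPQ : bil vform EP EQ = - (vform (snk G j) z + 1).
  rewrite EQv !bilDr !bilNr (vbil (z := z)) // !vP !degree_start // hr mulr0.
  by rewrite jj' zj' vzz degree_notin // zd1; ring.
have vSQ : bil vform ES EQ = - g.
  rewrite EQv !bilDr !bilNr (vbil (z := z)); last by move=> w; apply: suppS.
  by rewrite !vS degree_start // hr mulr0 zj' vzz degree_notin // -/g; ring.
have vPS : bil vform EP ES = - (vform z (snk G j) - g - (1 - g)).
  rewrite anti EPv !bilDr !bilNr (vbil (z := z)); last by move=> w; apply: suppS.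
  by rewrite !vS degree_start // zd1 mulr1 ESz vzz degree_notin // -/g; ring.
have qE E F : bil qform E F = bil hform E F - bil vform E F by exact: bil_subform.
rewrite !qE hPS hPQ hSQ vPQ vSQ vPS ESz.
by rewrite (conn_form_antisym _ (snk G j)); ring.
Qed.

(** [S] is the second path up to [z]; the first path up to [z] is a common left factor and is left
    out. Reversing the three factors takes three swaps, whose exponents are added in
    [crossing_exponent]. *)
Lemma crossing_weight :
  pw x z (d :: P) * pw x (src G i) S * pw x z (r :: Q) =
  q *: (pw x z (r :: Q) * pw x (src G i) S * pw x z (d :: P)).
Proof.
have cPS := qcomm_path z (d :: P) (src G i) S.
have cPQ := qcomm_path z (d :: P) z (r :: Q).
have cSQ := qcomm_path (src G i) S z (r :: Q).
rewrite cPS -scalerAl -(mulrA (pw x (src G i) S)) cPQ -scalerAr mulrA cSQ.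
rewrite -!scalerAl !scalerA.
by rewrite -!expfzDr // crossing_exponent expr1z.
Qed.

End Crossing.

End PathWeight.

(** * Adjacent transpositions *)

Section Adjacent.
Variables (k : nat) (a b : 'I_k).
Hypothesis ab : b = a.+1 :> nat.

Lemma tperm_adjacent_val (i : 'I_k) : (tperm a b i : nat) =
  if i == a :> nat then a.+1 else if i == a.+1 :> nat then (a : nat) else i.
Proof.
case: tpermP => [->|->|/eqP + /eqP]; rewrite ?ab ?eqxx //.
  by rewrite gtn_eqF.
by rewrite -!val_eqE /= ab => /negbTE-> /negbTE->.
Qed.

Lemma tperm_adjacent_lt (i j : 'I_k) : (i < j)%N -> (i, j) != (a, b) ->
  (tperm a b i < tperm a b j)%N.
Proof.
rewrite xpair_eqE negb_and -!val_eqE !tperm_adjacent_val /= ab.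
by do 4?case: ifP; lia.
Qed.

(** The transposition acts first in this product, so it permutes positions. It keeps the order of
    every pair of positions except [(a, b)], hence carries the inversions of [s] to the new ones
    other than [(a, b)]. *)
Lemma inv_count_tperm (s : 'S_k) : (s a < s b)%N ->
  inv_count (tperm a b * s)%g = (inv_count s).+1.
Proof.
move=> sab; rewrite /inv_count; set I1 := [set _ | _]; set I0 := [set _ | _].
pose f (p : 'I_k * 'I_k) := (tperm a b p.1, tperm a b p.2).
have fK : involutive f by case=> i j; rewrite /f /= !tpermK.
have abE : f (a, b) = (b, a) by rewrite /f /= tpermL tpermR.
have -> : I1 = (a, b) |: (f @: I0).
  apply/setP => p; have -> : (p \in (a, b) |: f @: I0) = (p == (a, b)) || (f p \in I0).
    by rewrite in_setU1 -{2}(fK p) mem_imset //; apply: inv_inj.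
  rewrite !inE.
  case: p => i j /=; rewrite !permM.
  have [[-> ->]|ne] /= := eqVneq (i, j) (a, b).
    by rewrite tpermL tpermR sab ab ltnSn.
  have [lij|lji] := ltnP i j; first by rewrite tperm_adjacent_lt.
  apply/esym/negP => /andP[lt1 lt2].
  have [[e1 e2]|ne'] := eqVneq (tperm a b i, tperm a b j) (a, b).
    by move: lt2; rewrite e1 e2 ltnNge (ltnW sab).
  by have := tperm_adjacent_lt lt1 ne'; rewrite !tpermK ltnNge lji.
rewrite cardsU1 card_imset; last exact: inv_inj fK.
rewrite -(fK (a, b)) (mem_imset _ _ (inv_inj fK)) abE !inE /= ab ltnNge leqnSn.
by rewrite add1n.
Qed.

(** In the noncommutative product the factors at [a] and [b] are neighbours. The contexts [c] and
    [d] are chosen before [g], so that they serve a family and its exchange alike. *)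
Lemma prod_adjacent (R : pzRingType) (f : 'I_k -> R) :
  exists c d, forall g : 'I_k -> R, (forall l, l != a -> l != b -> g l = f l) ->
    \prod_(l < k) g l = c * (g a * g b) * d.
Proof.
(* Natural indices allow the product to be cut at [a]; the default 1 concerns only indices outside
   the range of the product. *)
pose ext (g : 'I_k -> R) (i : nat) := oapp g 1 (insub i).
have extE g (l : 'I_k) : ext g l = g l by rewrite /ext valK.
have ak : (a.+2 <= k)%N by rewrite -ab.
exists (\prod_(0 <= i < a) ext f i), (\prod_(a.+2 <= i < k) ext f i) => g gf.
have extf (i : nat) : i != a -> i != b -> ext g i = ext f i.
  by move=> ia ib; rewrite /ext; case: insubP => //= l _ li; apply: gf;
     rewrite -val_eqE /= li.
transitivity (\prod_(0 <= i < k) ext g i).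
  by rewrite big_mkord; apply: eq_bigr => l _; rewrite extE.
rewrite (@big_cat_nat _ _ _ a) //; last by rewrite ltnW // ltnW.
rewrite /= (@big_ltn _ _ _ a) ?(ltnW ak) // (@big_ltn _ _ _ a.+1) // extE -ab extE !mulrA.
congr (_ * _ * _ * _); rewrite big_nat [RHS]big_nat; apply: eq_bigr => i.
  by move=> /= ia; apply: extf; lia.
by move=> /andP[bi _]; apply: extf; lia.
Qed.
End Adjacent.

(** An increasing map satisfies [i <= s i]; both sides have the same sum over all [i], so equality
    holds throughout. *)
Lemma perm_increasing k (s : 'S_k) :
  (forall i j : 'I_k, (i < j)%N -> (s i < s j)%N) -> s = 1%g.
Proof.
move=> s_incr.
suff ge (i : 'I_k) : (i <= s i)%N.
  apply/permP => i; rewrite perm1; apply/val_inj/eqP; rewrite eq_sym /=.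
  have /leqif_sum : forall j : 'I_k, true -> (j <= s j ?= iff (j == s j :> nat))%N.
    by move=> j _; split.
  case=> _; rewrite [X in (_ == X)%N](reindex_inj (@perm_inj _ s^-1)) /=.
  under [X in (_ == X)%N]eq_bigr do rewrite permKV.
  by rewrite eqxx => /esym/forall_inP/(_ i isT).
case: i => v vk; elim: v vk => [//|v IH] vk.
apply: leq_ltn_trans (IH (ltnW vk)) _; exact: s_incr.
Qed.

(** * Increasing enumeration of the index sets *)

Section Elt.
Variables (p : nat) (I : {set 'I_p}) (k : nat) (hI : #|I| = k).

Lemma elt_in l : elt hI l \in I.
Proof. exact: enum_valP. Qed.

Lemma elt_inj : injective (elt hI).
Proof. by move=> l l' /enum_val_inj/cast_ord_inj. Qed.

Lemma elt_onto i : i \in I -> exists l, i = elt hI l.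
Proof.
move=> iI; exists (cast_ord hI (enum_rank_in iI i)).
by rewrite /elt cast_ordK enum_rankK_in.
Qed.

Lemma elt_lt (l l' : 'I_k) : (l < l')%N -> (elt hI l < elt hI l')%N.
Proof.
move=> ll'; have i0 := elt hI l.
have srt : sorted (relpre val ltn) (enum I).
  apply: sorted_filter; first by move=> ? ? ?; apply: ltn_trans.
  by rewrite -enumT -sorted_map val_enum_ord iota_ltn_sorted.
rewrite /elt !(enum_val_nth i0).
have tr : transitive (relpre (val : 'I_p -> nat) ltn).
  by move=> ? ? ?; apply: ltn_trans.
by have := sorted_ltn_nth tr i0 srt; apply; rewrite ?inE -?cardE /= ?hI.
Qed.
End Elt.

(** * Exchanging the tails of two paths *)

Section Tails.
Variables (m n : nat) (G : SEgraph m n).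
Hypothesis hG : SE_axioms G.
Local Notation V := (vert G).
Local Notation edge := (@Defs.edge m n G).

Lemma pseq_inj : injective (@pseq m n G).
Proof.
move=> [l t] [l' t'] e.
have ll' : l = l' by apply: val_inj; rewrite /= -(size_tuple t) -(size_tuple t'); congr size.
by subst l'; congr existT; apply: val_inj.
Qed.

(** The default [p0] is returned for lists that are too long, which by [path_size] are never
    directed paths. *)
Definition ptype_of_seq (p0 : ptype G) (s : seq V) : ptype G :=
  match ltnP (size s) #|V| with
  | LtnNotGeq lt_s => Tagged (fun l : 'I_#|V| => l.-tuple V)
                        (in_tuple s : (Ordinal lt_s).-tuple V)
  | _ => p0
  end.

Lemma ptype_of_seqK p0 s : (size s < #|V|)%N -> pseq (ptype_of_seq p0 s) = s.
Proof. by move=> lt_s; rewrite /ptype_of_seq; case: ltnP => //; rewrite leqNgt lt_s. Qed.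

Definition swap_tail (z : V) (p p' : seq V) : seq V :=
  take (index z p).+1 p ++ drop (index z p').+1 p'.

Lemma swap_tailE z p1 p2 p1' p2' : z \notin p1 -> z \notin p1' ->
  swap_tail z (rcons p1 z ++ p2) (rcons p1' z ++ p2') = rcons p1 z ++ p2'.
Proof.
move=> zp zp'.
have idx s s' : z \notin s -> index z (rcons s z ++ s') = size s.
  move=> zs; rewrite index_cat mem_rcons mem_head -cats1 index_cat (negbTE zs).
  by rewrite /= eqxx addn0.
rewrite /swap_tail !idx // -{1}(size_rcons p1 z) -(size_rcons p1' z).
by rewrite take_size_cat // drop_size_cat.
Qed.

Definition last_meet (p p' : seq V) : option V :=
  [pick z | [&& z \in p, z \in p' &
    [forall w, (w \in p) && (w \in p') ==> (rank w <= rank z)]]].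

(** The choice made by [pick] depends on the set of common vertices alone. An exchange of tails
    keeps this set, so it can be undone at the same vertex. *)
Lemma last_meet_ext p p' s s' :
  (forall w, (w \in s) && (w \in s') = (w \in p) && (w \in p')) ->
  last_meet s s' = last_meet p p'.
Proof.
move=> h; apply: eq_pick => z; rewrite /= !andbA h; congr (_ && _).
by apply: eq_forallb => w; rewrite h.
Qed.

Lemma last_meet_spec p p' : (exists2 w, w \in p & w \in p') ->
  exists z, [/\ last_meet p p' = Some z, z \in p, z \in p' &
    forall w, w \in p -> w \in p' -> rank w <= rank z].
Proof.
case=> w wp wp'; rewrite /last_meet.
case: pickP => [z /and3P[zp zp' /forallP zmax]|none].
  exists z; split=> // v vp vp'; move: (zmax v); rewrite vp vp'; exact.
pose P v := (v \in p) && (v \in p').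
have Pw : P w by rewrite /P wp.
case: (arg_maxP (@rank m n G) Pw) => z /andP[zp zp'] zmax.
have := none z; rewrite zp zp' /= => /forallP[] v.
by apply/implyP => /zmax.
Qed.

(** The exchanged lists are indices, so a case analysis replaces them by their decompositions at
    [z]. *)
Variant tails_spec (a : V) (p : seq V) (b : V) (p' : seq V) (z : V) : seq V -> seq V -> Prop :=
  TailsSpec p1 p2 p1' p2' of last_meet p p' = Some z
    & p = rcons p1 z ++ p2 & p' = rcons p1' z ++ p2'
    & (forall w, w \in p2 -> w \in p2' -> False)
    & (forall w, (w \in rcons p1 z ++ p2') && (w \in rcons p1' z ++ p2) =
                 (w \in p) && (w \in p'))
    & z \notin p1 & z \notin p1'
    & path edge a (rcons p1 z) & path edge b (rcons p1' z)
    & path edge z p2 & path edge z p2' :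
  tails_spec a p b p' z (rcons p1 z ++ p2') (rcons p1' z ++ p2).

(** Initial parts have rank below [z] and tails above it, and by maximality of [z] the tails are
    disjoint. All common vertices, before and after the exchange, are thus [z] and those of the
    initial parts. *)
Lemma tailsP a p b p' : path edge a p -> path edge b p' ->
  (exists2 w, w \in p & w \in p') ->
  exists z, tails_spec a p b p' z (swap_tail z p p') (swap_tail z p' p).
Proof.
move=> pa pb /last_meet_spec [z [zE zp zp' zmax]]; exists z.
have splitz s c : path edge c s -> z \in s -> exists s1 s2,
   [/\ s = rcons s1 z ++ s2, z \notin s1, path edge c (rcons s1 z), path edge z s2
     & forall w, w \in s1 -> rank w < rank z].
  move=> ps zs; move: (ps); case/path.splitP: zs => s1 s2.
  rewrite cat_path last_rcons => /andP[p1 p2]; exists s1, s2.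
  have lt w : w \in s1 -> rank w < rank z.
    by move=> ws; apply: path_rank_last p1 _; rewrite // in_cons ws orbT.
  by split=> //; apply/negP => /lt; rewrite ltxx.
have [p1 [p2 [pE zp1 pp1 pp2 lt1]]] := splitz p a pa zp.
have [p1' [p2' [pE' zp1' pp1' pp2' lt1']]] := splitz p' b pb zp'.
have gt2 w : w \in p2 -> rank z < rank w by apply: path_rank pp2.
have gt2' w : w \in p2' -> rank z < rank w by apply: path_rank pp2'.
have dis w : w \in p2 -> w \in p2' -> False.
  move=> w2 w2'; have := gt2 w w2; rewrite ltNge zmax // ?pE ?pE' mem_cat ?w2 ?w2' orbT //.
rewrite {3}pE {3}pE' {2}pE {2}pE' !swap_tailE //; apply: (TailsSpec zE) => //.
move=> w; rewrite pE pE' !mem_cat !mem_rcons !in_cons.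
have [->|_] /= := eqVneq w z; first by [].
have x2 : (w \in p2) && (w \in p2') = false by apply/negP => /andP[/dis].
have x1 : (w \in p1) && (w \in p2') = false.
  by apply/negP => /andP[/lt1 l1 /gt2' /(lt_trans l1)]; rewrite ltxx.
have x1' : (w \in p1') && (w \in p2) = false.
  by apply/negP => /andP[/lt1' l1 /gt2 /(lt_trans l1)]; rewrite ltxx.
have x3 : (w \in p1) && (w \in p2) = false.
  by apply/negP => /andP[/lt1 l1 /gt2 /(lt_trans l1)]; rewrite ltxx.
have x3' : (w \in p1') && (w \in p2') = false.
  by apply/negP => /andP[/lt1' l1 /gt2' /(lt_trans l1)]; rewrite ltxx.
by move: x1 x1' x2 x3 x3'; do 4!case: (w \in _).
Qed.

End Tails.

(** * Weights of two paths before and after the exchange *)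

Section SwapWeight.
Variables (m n : nat) (G : SEgraph m n).
Hypothesis hG : SE_axioms G.
Local Notation V := (vert G).
Local Notation edge := (@Defs.edge m n G).
Variables (K : fieldType) (q : K) (A : unitAlgType K) (x : V -> A).
Hypotheses (hq : q != 0) (hx : qtorus_rel q x).

Lemma src_inj : injective (src G).
Proof.
move=> i i' e; apply: ord_inj.
by case: (ltngtP i i') => // /(src_up hG); rewrite e ltxx.
Qed.

Lemma snk_inj : injective (snk G).
Proof.
move=> i i' e; apply: ord_inj.
by case: (ltngtP i i') => // /(snk_right hG); rewrite e ltxx.
Qed.

Lemma path_head_not_src a p v : path edge a p -> v \in p -> ~~ is_src v.
Proof.
elim: p a => [|b p IH] a //= /andP[ab pp]; rewrite in_cons => /orP[/eqP ->|].
  exact: edge_head_not_src ab.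
exact: IH pp.
Qed.

(** A path ends at any sink it contains, so a common sink would be the end of both paths. *)
Lemma meet_not_snk a p b p' j j' z : path edge a p -> path edge b p' ->
  last a p = snk G j -> last b p' = snk G j' -> j != j' ->
  z \in a :: p -> z \in b :: p' -> ~~ is_snk z.
Proof.
move=> pa pb la lb jj' za zb; apply/existsP => -[t /eqP zt]; subst z.
have := snk_mem_path hG pa za; have := snk_mem_path hG pb zb.
rewrite la lb => /snk_inj <- /snk_inj e; by rewrite e eqxx in jj'.
Qed.

Lemma swap_weight i i' (j j' : 'I_n) p p' z s s' :
  path edge (src G i) p -> path edge (src G i') p' ->
  last (src G i) p = snk G j -> last (src G i') p' = snk G j' -> (j < j')%N ->
  tails_spec (src G i) p (src G i') p' z s s' ->
  pw x (src G i) p * pw x (src G i') p' =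
  q *: (pw x (src G i) s * pw x (src G i') s').
Proof.
move=> pp pp' + + jj' [p1 p2 p1' p2' _ pE pE' dis _ _ _ pz pz' pz2 pz2'].
have zp : z \in p by rewrite pE mem_cat mem_rcons mem_head.
have zp' : z \in p' by rewrite pE' mem_cat mem_rcons mem_head.
move=> lp lp'; have zsnk : ~~ is_snk z.
  by apply: (meet_not_snk pp pp' lp lp'); rewrite ?in_cons ?zp ?zp' ?orbT // neq_ltn jj'.
have iz : inner z by rewrite /inner zsnk (path_head_not_src pp zp).
move: lp lp'; rewrite {}pE {}pE' !pw_cat !last_cat !last_rcons.
case: p2 pz2 dis => [|d P] /=; first by move=> _ _ e; case/existsP: zsnk; exists j; rewrite e.
case/andP=> zd pP; case: p2' pz2' => [|r Q] /=.
  by move=> _ _ _ e; case/existsP: zsnk; exists j'; rewrite e.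
case/andP=> zr pQ dis lP lQ.
have zP : z \notin d :: P.
  by have : path edge z (d :: P) by [rewrite /= zd]; move=> /(path_uniq hG)/andP[].
have zQ : z \notin r :: Q.
  by have : path edge z (r :: Q) by [rewrite /= zr]; move=> /(path_uniq hG)/andP[].
have neq_dr : d != r by apply/eqP => e; apply: (dis d); rewrite ?e mem_head.
(* If [d] were reached by an H-edge, then [r] would be reached by a V-edge, and [d :: P] would run
   on the north-east side of the other tail and end further right, giving [j' < j]. *)
have vzd : vedge G z d.
  case/orP: (zd) => // hzd; case/orP: (zr) => [/(hedge_out_unique hG hzd) e|vzr].
    by rewrite e eqxx in neq_dr.
  suff : (j' < j)%N by rewrite ltnNge ltnW.
  apply: (disjoint_paths_order hG (a := z) (p := r :: Q) (b := d) (p' := P)) => //.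
  - by rewrite /= zr.
  - move=> v vP; rewrite in_cons negb_or; apply/andP; split.
      by apply: contraNneq zP => <-.
    by apply/negP; apply: dis.
  - exists z; first exact: mem_head.
    by have [-> /ltW] := hedge_geom hG hzd.
have hzr : hedge G z r.
  by case/orP: (zr) => // /(vedge_out_unique hG vzd) e; rewrite e eqxx in neq_dr.
have disz w : w \in z :: d :: P -> w \in z :: r :: Q -> w = z.
  rewrite in_cons => /orP[/eqP//|wP]; rewrite in_cons => /orP[/eqP//|wQ].
  by have := dis w wP wQ.
have lz : last (src G i') (rcons p1' z) = z by rewrite last_rcons.
have := crossing_weight hG hq hx pz' lz iz vzd hzr pP pQ lP lQ disz.
by rewrite -!mulrA => ->; rewrite -scalerAr.
Qed.

End SwapWeight.

(** * The sign-reversing involution *)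

Section Involution.
Variables (m n : nat) (G : SEgraph m n).
Hypothesis hG : SE_axioms G.
Local Notation V := (vert G).
Local Notation edge := (@Defs.edge m n G).
Variables (K : fieldType) (q : K) (A : unitAlgType K) (x : V -> A).
Hypotheses (hq : q != 0) (hx : qtorus_rel q x).
Variables (k : nat) (I : {set 'I_m}) (J : {set 'I_n}) (hI : #|I| = k) (hJ : #|J| = k).

Local Notation ffam := {ffun 'I_k -> ptype G}.
Local Notation s l := (src G (elt hI l)).
Local Notation t l := (snk G (elt hJ l)).
Implicit Types (F : ffam) (sg : 'S_k).

Definition track F l : seq V := s l :: pseq (F l).

Definition joins sg F := [forall l, is_path (s l) (t (sg l)) (pseq (F l))].

Definition disjoint_family F :=
  [forall l, forall l', (l != l') ==> [disjoint track F l & track F l']].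

(** Phrased by counting, because an exchange preserves the number of tracks through each vertex. *)
Definition meets F : {set V} :=
  [set v | (1 < #|[set l | v \in track F l]|)%N].

Lemma joinsP sg F l : joins sg F ->
  path edge (s l) (pseq (F l)) /\ last (s l) (pseq (F l)) = t (sg l).
Proof. by move/forallP/(_ l)/andP=> [? /eqP]. Qed.

Lemma meetsP F v :
  reflect (exists l l', [/\ l != l', v \in track F l & v \in track F l'])
          (v \in meets F).
Proof.
rewrite inE; apply: (iffP card_gt1P) => -[l [l' [h1 h2 h3]]]; exists l, l'.
  by rewrite !inE in h1 h2.
by rewrite !inE.
Qed.

Lemma disjoint_familyP F : reflect (meets F = set0) (disjoint_family F).
Proof.
apply: (iffP forallP) => [dis|m0 l].
  apply/setP => v; rewrite in_set0; apply/meetsP => -[l [l' [ll' h1 h2]]].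
  have /forallP/(_ l') := dis l; rewrite ll' /= => /pred0P/(_ v) /=.
  by rewrite h1 h2.
apply/forallP => l'; apply/implyP => ll'; apply/pred0P => v /=; apply/negP.
case/andP=> h1 h2; have : v \in meets F by apply/meetsP; exists l, l'.
by rewrite m0 in_set0.
Qed.

Lemma track_lt F (l l' : 'I_k) : (l < l')%N ->
  weakly_NE (track F l) (s l').
Proof.
move=> ll'; exists (s l); first exact: mem_head.
split; first by rewrite (src_line hG (elt hI l) (elt hI l')).
by apply/ltW/(src_up hG)/elt_lt.
Qed.

(** By [disjoint_paths_order] the sinks are reached in the order of the sources, so [sg] is
    increasing. *)
Lemma joins_disjoint_id sg F : joins sg F -> disjoint_family F -> sg = 1%g.
Proof.
move=> jF dF; apply: perm_increasing => l l' ll'.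
have [p1 e1] := joinsP l jF; have [p2 e2] := joinsP l' jF.
have : (elt hJ (sg l) < elt hJ (sg l'))%N.
  apply: (disjoint_paths_order hG p1 p2 e1 e2); last exact: track_lt.
  move=> v v2; apply/negP => v1.
  move/forallP: dF => /(_ l)/forallP/(_ l'); rewrite neq_ltn ll' /=.
  by move=> /pred0P/(_ v) /=; rewrite /track v1 v2.
rewrite !ltnNge; apply: contra; rewrite leq_eqVlt => /orP[/eqP/val_inj ->//|].
by move/(elt_lt hJ)/ltnW.
Qed.

(** A flow only requires its ends to lie in [J]. Disjointness makes the map to the ends injective,
    hence a permutation, which must then be the identity. *)
Lemma is_flowE F : is_flow hI hJ F = joins 1 F && disjoint_family F.
Proof.
apply/andP/andP => -[h dF]; split=> //; last first.
  apply/forallP => l; apply/existsP; exists (elt hJ l); rewrite elt_in /=.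
  by move/forallP/(_ l): h; rewrite perm1.
have ends l : [exists l', is_path (s l) (t l') (pseq (F l))].
  move/forallP/(_ l)/exists_inP: h => -[j jJ jp].
  by have [l' e] := elt_onto hJ jJ; apply/existsP; exists l'; rewrite -e.
pose e l := xchoose (existsP (ends l)).
have eP l : is_path (s l) (t (e l)) (pseq (F l)) := xchooseP (existsP (ends l)).
have e_inj : injective e.
  move=> l l' ll'; apply/eqP; apply: contraT => ne.
  move/forallP: dF => /(_ l)/forallP/(_ l'); rewrite ne /= => /pred0P/(_ (t (e l))) /=.
  have tl a : t (e a) \in s a :: pseq (F a).
    by have /andP[_ /eqP <-] := eP a; apply: mem_last.
  by rewrite tl ll' tl.
have jF : joins (perm e_inj) F by apply/forallP => l; rewrite permE.
by rewrite -(joins_disjoint_id jF dF).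
Qed.

Lemma qminor_expansion :
  qminor (pathmx x) q hI hJ =
  \sum_(c : 'S_k * ffam | joins c.1 c.2)
     ((- q) ^+ inv_count c.1) *: flow_weight x hI c.2.
Proof.
rewrite -(pair_big_dep xpredT joins
   (fun sg F => ((- q) ^+ inv_count sg) *: flow_weight x hI F)) /=.
apply: eq_bigr => sg _; rewrite -scaler_sumr; congr (_ *: _).
under eq_bigr do rewrite mxE.
rewrite bigA_distr_big_dep; apply: eq_bigl => F.
by apply/familyP/forallP => h l; have := h l.
Qed.

(** Two tracks start at distinct sources and no edge enters a source, so a common vertex is not a
    source. *)
Lemma track_meet_tail sg F l l' v : joins sg F -> l != l' ->
  v \in track F l -> v \in track F l' -> v \in pseq (F l).
Proof.
move=> jF ll'; rewrite in_cons => /orP[/eqP->|//].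
have is_s : is_src (s l) by apply/existsP; exists (elt hI l).
rewrite in_cons => /orP[/eqP /(src_inj hG)/elt_inj e|].
  by rewrite e eqxx in ll'.
by move/(path_head_not_src hG (proj1 (joinsP l' jF))); rewrite is_s.
Qed.

Definition swap_family F (a b : 'I_k) : ffam :=
  if last_meet (pseq (F a)) (pseq (F b)) is Some z then
    [ffun l =>
       if l == a then ptype_of_seq (F a) (swap_tail z (pseq (F a)) (pseq (F b)))
       else if l == b then ptype_of_seq (F b) (swap_tail z (pseq (F b)) (pseq (F a)))
       else F l]
  else F.

Lemma swap_familyP sg F a b : joins sg F -> a != b ->
  (exists2 v, v \in track F a & v \in track F b) ->
  let F' := swap_family F a b in
  exists z,
  [/\ tails_spec (s a) (pseq (F a)) (s b) (pseq (F b)) z (pseq (F' a)) (pseq (F' b)),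
      forall l, l != a -> l != b -> F' l = F l & swap_family F' a b = F].
Proof.
move=> jF ab [v va vb]; have ba : b != a by rewrite eq_sym.
have [pa _] := joinsP a jF; have [pb _] := joinsP b jF.
have [z tz] : exists z, tails_spec (s a) (pseq (F a)) (s b) (pseq (F b)) z
    (swap_tail z (pseq (F a)) (pseq (F b))) (swap_tail z (pseq (F b)) (pseq (F a))).
  apply: tailsP => //; exists v.
    exact: track_meet_tail jF ab va vb.
  exact: track_meet_tail jF ba vb va.
exists z; set F' := swap_family F a b.
have lz : last_meet (pseq (F a)) (pseq (F b)) = Some z by case: tz.
have F'E l : F' l =
    if l == a then ptype_of_seq (F a) (swap_tail z (pseq (F a)) (pseq (F b)))
    else if l == b then ptype_of_seq (F b) (swap_tail z (pseq (F b)) (pseq (F a)))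
    else F l by rewrite /F' /swap_family lz ffunE.
have F'a : pseq (F' a) = swap_tail z (pseq (F a)) (pseq (F b)).
  rewrite F'E eqxx ptype_of_seqK //.
  case: tz => p1 p2 p1' p2' _ _ _ _ _ _ _ pz _ _ pz2.
  by apply: (path_size hG (a := s a)); rewrite cat_path pz last_rcons.
have F'b : pseq (F' b) = swap_tail z (pseq (F b)) (pseq (F a)).
  rewrite F'E eqxx (negbTE ba) ptype_of_seqK //.
  case: tz => p1 p2 p1' p2' _ _ _ _ _ _ _ _ pz pz2 _.
  by apply: (path_size hG (a := s b)); rewrite cat_path pz last_rcons.
have F'l l : l != a -> l != b -> F' l = F l.
  by move=> /negbTE la /negbTE lb; rewrite F'E la lb.
split=> //; first by rewrite F'a F'b.
(* The second exchange cuts at the same vertex and therefore restores both paths. *)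
have lz' : last_meet (pseq (F' a)) (pseq (F' b)) = Some z.
  by rewrite -lz; apply: last_meet_ext => w; rewrite F'a F'b; case: tz.
apply/ffunP => l; rewrite /swap_family lz' ffunE; apply: pseq_inj.
have bounds c : (size (pseq (F c)) < #|V|)%N.
  by apply: (path_size hG (a := s c)); have [] := joinsP c jF.
have unswap : swap_tail z (pseq (F' a)) (pseq (F' b)) = pseq (F a) /\
              swap_tail z (pseq (F' b)) (pseq (F' a)) = pseq (F b).
  rewrite F'a F'b; case: tz => p1 p2 p1' p2' _ -> -> _ _ n1 n2 *.
  by rewrite !swap_tailE.
case: eqVneq => [->|la]; first by rewrite (proj1 unswap) ptype_of_seqK.
case: eqVneq => [->|lb]; first by rewrite (proj2 unswap) ptype_of_seqK.
by rewrite F'l.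
Qed.

Lemma swap_family_joins sg F a b : joins sg F -> a != b ->
  (exists2 v, v \in track F a & v \in track F b) ->
  joins (tperm a b * sg)%g (swap_family F a b).
Proof.
move=> jF ab mt; have [z [tz Fl _]] := swap_familyP jF ab mt.
have [_ la] := joinsP a jF; have [_ lb] := joinsP b jF.
apply/forallP => l; rewrite permM /is_path; have [->|na] := eqVneq l a.
  move: lb; rewrite tpermL; case: tz => p1 p2 p1' p2' _ _ -> _ _ _ _ pz _ _ pz2.
  by rewrite cat_path !last_cat !last_rcons pz pz2 => ->; rewrite eqxx.
have [->|nb] := eqVneq l b.
  move: la; rewrite tpermR; case: tz => p1 p2 p1' p2' _ -> _ _ _ _ _ _ pz pz2 _.
  by rewrite cat_path !last_cat !last_rcons pz pz2 => ->; rewrite eqxx.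
have -> : tperm a b l = l by rewrite tpermD // eq_sym.
by rewrite Fl //; move/forallP/(_ l): jF.
Qed.

Lemma swap_family_track sg F a b v : joins sg F -> a != b ->
  (exists2 v, v \in track F a & v \in track F b) ->
  let F' := swap_family F a b in
  (v \in track F' a) && (v \in track F' b) = (v \in track F a) && (v \in track F b) /\
  (v \in track F' a) || (v \in track F' b) = (v \in track F a) || (v \in track F b).
Proof.
move=> jF ab mt F'; have jF' := swap_family_joins jF ab mt.
have ba : b != a by rewrite eq_sym.
have [z [tz Fl _]] := swap_familyP jF ab mt.
have tailE sg0 F0 : joins sg0 F0 -> (v \in track F0 a) && (v \in track F0 b) =
    (v \in pseq (F0 a)) && (v \in pseq (F0 b)).
  move=> j0; apply/andP/andP => -[h1 h2].
    by rewrite (track_meet_tail j0 ab h1 h2) (track_meet_tail j0 ba h2 h1).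
  by rewrite /track !in_cons h1 h2 !orbT.
split; first by rewrite (tailE _ _ jF) (tailE _ _ jF'); case: tz.
rewrite /track !in_cons -/F'; case: tz => p1 p2 p1' p2' _ -> -> *.
rewrite !mem_cat !mem_rcons !in_cons.
by do 7!case: (_ == _) || case: (_ \in _).
Qed.

Lemma swap_family_meets sg F a b : joins sg F -> a != b ->
  (exists2 v, v \in track F a & v \in track F b) ->
  meets (swap_family F a b) = meets F.
Proof.
move=> jF ab mt; apply/setP => v; rewrite !inE; congr (1 < _)%N.
have [_ [_ Fl _]] := swap_familyP jF ab mt.
have [andE orE] := swap_family_track v jF ab mt.
have ba : b != a by rewrite eq_sym.
have cnt F0 : #|[set l | v \in track F0 l]| =
    ((v \in track F0 a) + (v \in track F0 b) +
     \sum_(i < k | (i != a) && (i != b)) (v \in track F0 i))%N.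
  rewrite -sum1dep_card big_mkcond (bigD1 a) // (bigD1 b) //= addnA.
  by congr (_ + _ + _)%N; try apply: eq_bigr => i _; case: (v \in _).
rewrite !cnt; congr (_ + _)%N.
  by move: andE orE; do 4!case: (v \in _).
by apply: eq_bigr => l /andP[la lb]; rewrite /track Fl.
Qed.

Definition first_meet F : option V :=
  [pick z in meets F | [forall w in meets F, rank z <= rank w]].

(** The choice uses only [meets F] and the tracks through the first meeting vertex, both of which
    the exchange preserves. *)
Definition crossing_pair F : option ('I_k * 'I_k) :=
  if first_meet F is Some z then
    [pick c : 'I_k * 'I_k |
      [&& c.2 == c.1.+1 :> nat, z \in track F c.1 & z \in track F c.2]]
  else None.

Lemma first_meet_spec F : ~~ disjoint_family F ->
  exists z, [/\ first_meet F = Some z, z \in meets F &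
    forall w, w \in meets F -> rank z <= rank w].
Proof.
move=> dF; have /set0Pn[v vm] : meets F != set0.
  by apply: contra dF => /eqP/disjoint_familyP.
rewrite /first_meet; case: pickP => [z /andP[zm /forall_inP zmin]|none].
  by exists z.
case: (arg_minP (P := mem (meets F)) (@rank m n G) vm) => z zm zmin.
have zm' : z \in meets F by exact: zm.
have := none z; rewrite /= zm' /= => /forall_inP[] w; exact: zmin.
Qed.

Lemma path_pred a p z : path edge a p -> z \in p -> exists2 u, u \in a :: p & edge u z.
Proof.
elim: p a => [|b p IH] a //= /andP[ab pp]; rewrite in_cons => /orP[/eqP ->|zp].
  by exists a; rewrite ?mem_head.
by have [u up uz] := IH b pp zp; exists u; rewrite // in_cons up orbT.
Qed.

(** * The first meeting vertex lies on two consecutive paths *)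

Section FirstMeet.
Variables (sg : 'S_k) (F : ffam) (z : V).
Hypotheses (jF : joins sg F) (zmin : forall w, w \in meets F -> rank z <= rank w).

Lemma first_meet_before l l' w : l != l' -> w \in track F l -> w \in track F l' ->
  (rank w < rank z) = false.
Proof.
by move=> ll' h1 h2; rewrite ltNge zmin //; apply/meetsP; exists l, l'.
Qed.

(** At most one H-edge and one V-edge enter [z], so two of the three paths would share the
    predecessor of [z], an earlier meeting. *)
Lemma first_meet_two (l1 l2 l3 : 'I_k) : l1 != l2 -> l1 != l3 -> l2 != l3 ->
  z \in track F l1 -> z \in track F l2 -> z \in track F l3 -> False.
Proof.
move=> n12 n13 n23 z1 z2 z3.
have pre l l' : l != l' -> z \in track F l -> z \in track F l' ->
    exists2 u, u \in track F l & edge u z.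
  move=> ll' h1 h2; have [pl _] := joinsP l jF.
  exact: path_pred pl (track_meet_tail jF ll' h1 h2).
have [u1 u1P e1] := pre _ _ n12 z1 z2.
have [u2 u2P e2] := pre _ _ n23 z2 z3.
have n31 : l3 != l1 by rewrite eq_sym.
have [u3 u3P e3] := pre _ _ n31 z3 z1.
have diff l l' u u' : l != l' -> u \in track F l -> u' \in track F l' ->
    edge u z -> u = u' -> False.
  move=> ll' h1 h2 /(edge_rank hG) + e; subst u'.
  by rewrite (first_meet_before ll' h1 h2).
have d12 := diff _ _ _ _ n12 u1P u2P e1.
have d13 := diff _ _ _ _ n13 u1P u3P e1.
have d23 := diff _ _ _ _ n23 u2P u3P e2.
have hin := @hedge_in_unique _ _ _ hG z; have vin := @vedge_in_unique _ _ _ hG z.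
case/orP: e1 => e1; case/orP: e2 => e2; case/orP: e3 => e3;
  by [apply: d12; eauto | apply: d13; eauto | apply: d23; eauto].
Qed.

(** A path starting between the two sources avoids both initial parts up to [z], by minimality of
    [z] and [first_meet_two]. It would be caught between them, against [trapped_path]. *)
Lemma first_meet_adjacent (a b : 'I_k) : (a < b)%N ->
  z \in track F a -> z \in track F b -> b = a.+1 :> nat.
Proof.
move=> ab za zb; apply/eqP; rewrite eqn_leq ab andbT leqNgt; apply/negP => lt_b.
have ck : (a.+1 < k)%N by apply: ltn_trans lt_b (ltn_ord b).
pose c := Ordinal ck.
have nab : a != b by rewrite neq_ltn ab.
have nac : a != c by rewrite neq_ltn /= ltnSn.
have nbc : b != c by rewrite neq_ltn /= lt_b orbT.
have nba : b != a by rewrite eq_sym.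
have [pa la] := joinsP a jF; have [pb lb] := joinsP b jF.
have [pc lc] := joinsP c jF.
have zs : ~~ is_snk z.
  apply: (meet_not_snk hG pa pb la lb) => //.
  by rewrite (inj_eq (@elt_inj _ _ _ hJ)) (inj_eq perm_inj).
have cut l l' : l != l' -> l != c -> z \in track F l -> z \in track F l' ->
    exists p, [/\ path edge (s l) p, last (s l) p = z &
                  {in track F c, forall v, v \notin s l :: p}].
  move=> ll' lc' zl zl'; have zp := track_meet_tail jF ll' zl zl'.
  have [p1 [p2 eP]] : exists p1 p2, pseq (F l) = rcons p1 z ++ p2.
    by case/path.splitP: zp => p1 p2; exists p1, p2.
  have [pl _] := joinsP l jF; move: pl; rewrite eP cat_path => /andP[pl _].
  exists (rcons p1 z); rewrite last_rcons; split=> //.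
  move=> v vc; apply/negP => vl.
  have vl' : v \in track F l.
    by rewrite /track eP; move: vl; rewrite !in_cons mem_cat => /orP[->|->]; rewrite ?orbT.
  have [vz|vz] := eqVneq v z.
    by subst v; apply: (@first_meet_two a b c).
  suff vlt : rank v < rank z by have := first_meet_before lc' vl' vc; rewrite vlt.
  apply: (path_rank_last hG pl); move: vl; rewrite !in_cons mem_rcons in_cons.
  by rewrite (negbTE vz).
have [p [pp lp dp]] := cut a b nab nac za zb.
have [p' [pp' lp' dp']] := cut b a nba nbc zb za.
apply: (trapped_path hG pp pp' lp lp' zs pc lc) => [v vc||].
- by rewrite dp ?dp'.
- exists (s a); first exact: mem_head.
  split; first by rewrite (src_line hG (elt hI a) (elt hI c)).
  by apply/ltW/(src_up hG)/elt_lt.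
- exists (s b); first exact: mem_head.
  split; first by rewrite (src_line hG (elt hI c) (elt hI b)).
  by apply/ltW/(src_up hG)/elt_lt.
Qed.
End FirstMeet.

Lemma crossing_pair_spec sg F : joins sg F -> ~~ disjoint_family F ->
  exists a b z, [/\ crossing_pair F = Some (a, b), first_meet F = Some z,
    b = a.+1 :> nat, z \in track F a & z \in track F b].
Proof.
move=> jF dF; have [z [fz zm zmin]] := first_meet_spec dF.
rewrite /crossing_pair fz; case: pickP => [[a b] /and3P[/eqP ab za zb]|none].
  by exists a, b, z.
have [l [l' [ll' zl zl']]] := meetsP _ _ zm.
wlog lt_l : l l' ll' zl zl' / (l < l')%N => [th|].
  case: (ltnP l l') => [|l'l]; first exact: th.
  by apply: (th l' l) => //; rewrite 1?eq_sym // ltn_neqAle l'l eq_sym ll'.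
have := none (l, l'); rewrite /= zl zl' andbT.
by rewrite (first_meet_adjacent jF zmin lt_l zl zl') eqxx.
Qed.

Definition exchange (c : 'S_k * ffam) : 'S_k * ffam :=
  if crossing_pair c.2 is Some (a, b) then
    ((tperm a b * c.1)%g, swap_family c.2 a b)
  else c.

(** Singles out one member of each pair of crossing families related by [exchange]. *)
Definition ascending (c : 'S_k * ffam) : bool :=
  if crossing_pair c.2 is Some (a, b) then (c.1 a < c.1 b)%N else false.

Definition weight (c : 'S_k * ffam) : A :=
  ((- q) ^+ inv_count c.1) *: flow_weight x hI c.2.

Definition crossing (c : 'S_k * ffam) : bool :=
  joins c.1 c.2 && ~~ disjoint_family c.2.

(** * Properties of the exchange on crossing families *)

Section Exchange.
Variable c : 'S_k * ffam.
Hypothesis cc : crossing c.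

Lemma crossing_pair_swap a b : crossing_pair c.2 = Some (a, b) ->
  crossing_pair (swap_family c.2 a b) = Some (a, b).
Proof.
case/andP: cc => jF dF; have [a' [b' [z [cE fz ab za zb]]]] := crossing_pair_spec jF dF.
rewrite cE => -[? ?]; subst a' b'; rewrite -cE.
have nab : a != b by rewrite -val_eqE /= ab neq_ltn ltnSn.
have mt : exists2 v, v \in track c.2 a & v \in track c.2 b by exists z.
have fz' : first_meet (swap_family c.2 a b) = Some z.
  by rewrite /first_meet (swap_family_meets jF nab mt).
have [_ [_ Fl _]] := swap_familyP jF nab mt.
have [andE _] := swap_family_track z jF nab mt.
rewrite /crossing_pair fz fz'; apply: eq_pick => -[l l'] /=.
have trE l0 : (z \in track (swap_family c.2 a b) l0) = (z \in track c.2 l0).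
  move: andE; rewrite za zb => /andP[za' zb'].
  have [->|na] := eqVneq l0 a; first by rewrite za za'.
  have [->|nb] := eqVneq l0 b; first by rewrite zb zb'.
  by rewrite /track Fl.
by rewrite !trE.
Qed.

Lemma exchangeK : exchange (exchange c) = c.
Proof.
case/andP: (cc) => jF dF; have [a [b [z [cE fz ab za zb]]]] := crossing_pair_spec jF dF.
have nab : a != b by rewrite -val_eqE /= ab neq_ltn ltnSn.
have mt : exists2 v, v \in track c.2 a & v \in track c.2 b by exists z.
have [_ [_ _ FK]] := swap_familyP jF nab mt.
rewrite {2}/exchange cE /exchange /= (crossing_pair_swap cE) FK mulgA tperm2 mul1g.
by case: (c).
Qed.

Lemma exchange_crossing : crossing (exchange c).
Proof.
case/andP: (cc) => jF dF; have [a [b [z [cE fz ab za zb]]]] := crossing_pair_spec jF dF.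
have nab : a != b by rewrite -val_eqE /= ab neq_ltn ltnSn.
have mt : exists2 v, v \in track c.2 a & v \in track c.2 b by exists z.
rewrite /exchange cE /crossing (swap_family_joins jF nab mt) /=.
apply: contra dF => /disjoint_familyP; rewrite (swap_family_meets jF nab mt).
by move/disjoint_familyP.
Qed.

Lemma exchange_ascending : ascending (exchange c) = ~~ ascending c.
Proof.
case/andP: (cc) => jF dF; have [a [b [z [cE fz ab za zb]]]] := crossing_pair_spec jF dF.
have nab : a != b by rewrite -val_eqE /= ab neq_ltn ltnSn.
rewrite /ascending /exchange cE /= (crossing_pair_swap cE) !permM tpermL tpermR.
have : (c.1 a != c.1 b :> nat) by rewrite (inj_eq (@ord_inj k)) (inj_eq perm_inj).
by case: ltngtP.
Qed.

(** The exchange adds one inversion, hence a factor [- q], while by [swap_weight] the old product of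
    path weights is [q] times the new one. *)
Lemma exchange_weight : ascending c -> weight (exchange c) = - weight c.
Proof.
case/andP: (cc) => jF dF; have [a [b [z [cE fz ab za zb]]]] := crossing_pair_spec jF dF.
have nab : a != b by rewrite -val_eqE /= ab neq_ltn ltnSn.
have mt : exists2 v, v \in track c.2 a & v \in track c.2 b by exists z.
rewrite /ascending /weight /exchange cE /= => asc.
have [y [ty Fl _]] := swap_familyP jF nab mt.
have [pa la] := joinsP a jF; have [pb lb] := joinsP b jF.
have sw := swap_weight hG hq hx pa pb la lb (elt_lt hJ asc) ty.
have [u [v uv]] := prod_adjacent ab (fun l => pw x (s l) (pseq (c.2 l))).
rewrite (inv_count_tperm ab asc) exprS -scalerA /flow_weight.
rewrite uv; last by move=> l la' lb'; rewrite Fl.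
rewrite (uv (fun l => pw x (s l) (pseq (c.2 l)))) // sw.
rewrite -scalerAr -scalerAl !scalerA mulNr scaleNr; congr (- (_ *: _)).
by rewrite mulrC.
Qed.

End Exchange.

Lemma crossing_weight_sum : \sum_(c | crossing c) weight c = 0.
Proof.
rewrite (bigID ascending) /= addrC.
(* The sum over the families that are not ascending is reindexed by the exchange, to cancel the
   ascending half term by term. *)
rewrite (reindex_onto exchange exchange) /=; last first.
  by move=> c /andP[cc _]; apply: exchangeK.
rewrite -[X in _ + X]opprK -sumrN; apply/eqP; rewrite subr_eq0; apply/eqP.
have cond c : crossing (exchange c) && ~~ ascending (exchange c) &&
    (exchange (exchange c) == c) = crossing c && ascending c.
  apply/andP/andP => [[/andP[cc nasc] /eqP e]|[cc asc]].
    have cc' := exchange_crossing cc; rewrite e in cc'; split=> //.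
    by rewrite exchange_ascending // negbK in nasc.
  by rewrite exchange_crossing // exchange_ascending // asc exchangeK // eqxx.
apply: eq_big => c; first exact: cond.
by rewrite cond => /andP[cc asc]; apply: exchange_weight.
Qed.

Lemma inv_count1 : inv_count (1 : 'S_k) = 0%N.
Proof.
apply/eqP; rewrite cards_eq0; apply/eqP/setP => -[i j]; rewrite !inE !perm1 /=.
by case: ltngtP.
Qed.

(** The crossing terms cancel; the disjoint ones occur only for the identity permutation, with
    coefficient 1. *)
Lemma qminor_flows : qminor (pathmx x) q hI hJ =
  \sum_(F : ffam | is_flow hI hJ F) flow_weight x hI F.
Proof.
rewrite qminor_expansion (bigID (fun c => disjoint_family c.2)) /=.
rewrite crossing_weight_sum addr0.
transitivity (\sum_(c : 'S_k * ffam | (c.1 == 1%g) && is_flow hI hJ c.2) weight c).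
  apply: eq_bigl => -[sg F] /=; rewrite is_flowE.
  apply/andP/and3P => [[jF dF]|[/eqP-> //]].
  by have e := joins_disjoint_id jF dF; rewrite -e jF dF e.
rewrite -(pair_big_dep (fun sg => sg == 1%g) (fun _ => is_flow hI hJ)
  (fun sg F => weight (sg, F))) /= big_pred1_eq.
by apply: eq_bigr => F _; rewrite /weight inv_count1 expr0 scale1r.
Qed.
End Involution.

Theorem theorem3p1 (K : fieldType) (q : K) (hq : q != 0) (m n : nat)
  (G : SEgraph m n) (hG : SE_axioms G)
  (A : unitAlgType K) (x : vert G -> A) (hx : qtorus_rel q x)
  (k : nat) (I : {set 'I_m}) (J : {set 'I_n}) (hI : #|I| = k) (hJ : #|J| = k) :
  qminor (pathmx x) q hI hJ =
  \sum_(F : {ffun 'I_k -> ptype G} | is_flow hI hJ F) flow_weight x hI F.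
Proof. exact: qminor_flows. Qed.
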